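(* Let $G$ be a Cayley graph of a finitely generated group $\Gamma$ and let $H_1\subseteq H_2\subseteq\Gamma$ be subgroups of $\Gamma$. If $H_1$ is $wq$-normal in $H_2$ then, for each $p\in[0,1]$, $G_p$ contains a unique $H_1$-infinite cluster almost surely if and only if it contains a unique $H_2$-infinite cluster almost surely. In particular, $p_u(H_1;G)=p_u(H_2;G)$, and if $H\subseteq\Gamma$ is a $wq$-normal subgroup of $\Gamma$ then $p_u(H;G)=p_u(G)$.
   Context: An infinite subgroup $H$ of a group $\Lambda$ is $wq$-normal in $\Lambda$ if for every intermediate subgroup $H\subseteq I\subsetneq\Lambda$ there exists $g\in\Lambda\setminus I$ such that $gIg^{-1}\cap I$ is infinite. Cayley graphs are taken with respect to finite generating sets. $G_p$ denotes Bernoulli bond percolation on $G$: each edge is independently retained (open) with probability $p$ and deleted otherwise; connected components of $G_p$ are called clusters. For a set $A$ of vertices, a cluster $K$ is called $A$-infinite if $|K\cap A|=\infty$. The relative uniqueness threshold is $p_u(A;G)=\inf\{p\in[0,1]:\text{there exists a unique }A\text{-infinite cluster in }G_p\text{ a.s.}\}$, and $p_u(G)=\inf\{p\in[0,1]:G_p\text{ has exactly one infinite cluster a.s.}\}$. *)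

(* Defs.v *)
From HB Require Import structures.
From mathcomp Require Import all_boot all_order all_algebra.
From mathcomp Require Import all_classical all_reals all_analysis measurable_realfun.
From mathcomp Require Import ring.

Set Implicit Arguments.
Unset Strict Implicit.
Unset Printing Implicit Defensive.
Import Order.TTheory GRing.Theory Num.Theory.

Local Open Scope classical_set_scope.
Local Open Scope ring_scope.

Section Subgroups.
Variable G : groupType.
Implicit Types H L I S : set G.

Definition subgroup H : Prop := group_closed [in H].

Definition generates S : Prop :=
  forall H, subgroup H -> S `<=` H -> H = [set: G].

Definition conj_set (g : G) I : set G := [set (g * x * g^-1)%g | x in I].

Definition wq_normal H L : Prop :=
  [/\ subgroup H, H `<=` L, infinite_set H &
      forall I, subgroup I -> H `<=` I -> I `<` L ->
        exists2 g, (L `\` I) g & infinite_set (conj_set g I `&` I)].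

End Subgroups.

(* Edges are unordered pairs of distinct vertices, so the Cayley graph is a
   simple graph; S need not be symmetric and may contain 1. *)
Section CayleyGraph.
Variables (G : groupType) (S : set G).

Definition cayley_adj (u v : G) : Prop :=
  u != v /\ (S (u^-1 * v)%g \/ S (v^-1 * u)%g).

Definition cayley_edges : set (set G) :=
  [set e | exists u v, cayley_adj u v /\ e = [set u; v]].

Definition edge : choiceType := set_type cayley_edges.

End CayleyGraph.

Section BernoulliMeasure.
Variables (R : realType) (E : choiceType).

Definition open_cylinders : set (set (E -> bool)) :=
  range (fun e => [set w : E -> bool | w e]).

Definition config : measurableType open_cylinders.-sigma :=
  g_sigma_algebraType open_cylinders.

Definition is_bernoulli (p : R) (P : probability config R) : Prop :=
  forall (s : seq E) (t : E -> bool), uniq s ->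
    P [set w : E -> bool | forall e, e \in s -> w e = t e] =
    (\prod_(e <- s) (if t e then p else 1 - p))%:E.

(* The product measure: is_bernoulli p determines its values on measurable
   sets (bernoulli_unique) and is satisfied by bernoulli p when E is countable
   and p is in [0, 1] (bernoulliP); percolationP is the case of Cayley graphs. *)
Definition bernoulli (p : R) : probability config R := get (is_bernoulli p).

End BernoulliMeasure.

Section Percolation.
Variables (R : realType) (G : groupType) (S : set G).
Implicit Types (w : config (edge S)) (A : set G) (p : R).

Definition open_adj w (u v : G) : Prop :=
  exists2 e : edge S, val e = [set u; v] & w e.

Definition connected_in w (u v : G) : Prop :=
  exists2 s : seq G, path (fun x y => `[< open_adj w x y >]) u s & v = last u s.

Definition clusters w : set (set G) := range (fun u => [set v | connected_in w u v]).

Definition unique_infinite_cluster A w : Prop :=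
  exists! K, clusters w K /\ infinite_set (K `&` A).

Definition as_unique_infinite_cluster p A : Prop :=
  {ae bernoulli (edge S) p, forall w, unique_infinite_cluster A w}.

Definition p_u_rel A : R :=
  inf [set p : R | 0 <= p <= 1 /\ as_unique_infinite_cluster p A].

Definition p_u : R :=
  inf [set p : R | 0 <= p <= 1 /\
    {ae bernoulli (edge S) p, forall w,
       exists! K, clusters w K /\ infinite_set K}].

End Percolation.

Section Existence.
Variable R : realType.
Implicit Types (p x : R).

(* bit p n x are the digits of x in [0, 1[ for the subdivision ratio p : 1 - p;
   under the uniform law they are independent Bernoulli(p) variables. *)
Definition bstep p x : R := if x < p then x / p else (x - p) / (1 - p).
Definition bit p (n : nat) x : bool := iter n (bstep p) x < p.

Definition wt p (b : bool) : R := if b then p else 1 - p.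

Lemma bitS p n x : bit p n.+1 x = bit p n (bstep p x).
Proof. by rewrite /bit iterSr. Qed.

Lemma prefix_itv p : 0 <= p <= 1 -> forall bs : seq bool, exists a : R,
  [/\ 0 <= a, a + \prod_(b <- bs) wt p b <= 1 &
  forall x, (0 <= x < 1 /\ forall i, (i < size bs)%N -> bit p i x = nth false bs i)
   <-> a <= x < a + \prod_(b <- bs) wt p b].
Proof.
move=> /andP[p0 p1]; elim => [|b bs [a [a0 a1 IH]]].
  exists 0; rewrite big_nil add0r; split=> // x; split=> [[]//|xx]; split => //.
rewrite big_cons; set l := \prod_(b <- bs) wt p b in a1 IH *.
have bitE x : (forall i, (i < size (b :: bs))%N -> bit p i x = nth false (b :: bs) i)
   <-> ((x < p) = b /\ forall i, (i < size bs)%N -> bit p i (bstep p x) = nth false bs i).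
  split=> [h|[h0 h] [//|i]].
    by split=> [|i ib]; [exact: (h 0%N) | rewrite -bitS h].
  by rewrite ltnS /= bitS; exact: h.
have l0 : 0 <= l by apply: prodr_ge0 => -[] _; rewrite /wt ?subr_ge0.
case: b bitE => bitE; rewrite /wt.
- exists (p * a); split; first by rewrite mulr_ge0.
    by rewrite -mulrDr mulr_ile1// addr_ge0.
  move=> x; rewrite bitE -mulrDr.
  have [p00|pn0] := eqVneq p 0.
    rewrite p00 !mul0r; split=> [[/andP[x0 _] [x1 _]]|/andP[x0 x1]].
      by move: (le_lt_trans x0 x1); rewrite ltxx.
    by move: (le_lt_trans x0 x1); rewrite ltxx.
  have pp : 0 < p by rewrite lt_neqAle eq_sym pn0.
  have E1 : (p * a <= x < p * (a + l)) = (a <= x / p < a + l).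
    by rewrite ler_pdivlMr// ltr_pdivrMr// ![p * _]mulrC.
  rewrite E1; split=> [[/andP[x0 x1] [xp h]]|h].
    rewrite -(IH (x / p)); split.
      by rewrite divr_ge0//= ltr_pdivrMr// mul1r.
    by move: h; rewrite /bstep xp.
  have [/andP[y0 y1] h'] := (IH (x / p)).2 h.
  have xp : x < p by move: y1; rewrite ltr_pdivrMr// mul1r.
  split; last by rewrite /bstep xp.
  rewrite (lt_le_trans xp)// andbT.
  by move: y0; rewrite pmulr_lge0// invr_gt0.
- exists (p + (1 - p) * a); split; first by rewrite addr_ge0// mulr_ge0// subr_ge0.
    rewrite -addrA -mulrDr -lerBrDl ler_piMr// ?subr_ge0//.
  move=> x; rewrite bitE -addrA -mulrDr.
  have [p11|pn1] := eqVneq p 1.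
    rewrite p11 subrr !mul0r addr0; split=> [[/andP[_ x0] [x1 _]]|/andP[x0 x1]].
      by rewrite x0 in x1.
    by move: (le_lt_trans x0 x1); rewrite ltxx.
  have qq : 0 < 1 - p by rewrite subr_gt0 lt_neqAle pn1.
  have E1 : (p + (1 - p) * a <= x < p + (1 - p) * (a + l)) =
            (a <= (x - p) / (1 - p) < a + l).
    by rewrite ler_pdivlMr// ltr_pdivrMr// ![_ * (1 - p)]mulrC lerBrDl ltrBlDl.
  rewrite E1; split=> [[/andP[x0 x1] [xp h]]|h].
    rewrite -(IH ((x - p) / (1 - p))); split.
      rewrite divr_ge0 ?subr_ge0 ?leNgt ?xp//=; last by rewrite -leNgt.
      by rewrite ltr_pdivrMr// mul1r ltrD2r.
    by move: h; rewrite /bstep xp.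
  have [/andP[y0 y1] h'] := (IH ((x - p) / (1 - p))).2 h.
  have xp : p <= x by move: y0; rewrite pmulr_lge0 ?invr_gt0// subr_ge0.
  have xpF : (x < p) = false by rewrite ltNge xp.
  split; last by rewrite /bstep xpF.
  rewrite (le_trans p0 xp)/=.
  by move: y1; rewrite ltr_pdivrMr// mul1r ltrD2r.
Qed.

End Existence.

Lemma measurable_bstep (R : realType) (p : R) : measurable_fun setT (bstep p).
Proof.
rewrite /bstep; apply: measurable_fun_if => //.
- exact: measurable_fun_ltr.
- by apply: measurable_funTS; apply: measurable_funM.
- apply: measurable_funTS; apply: measurable_funM => //.
  exact: measurable_funB.
Qed.

Lemma measurable_bit (R : realType) (p : R) n : measurable_fun setT (bit p n).
Proof.
apply: measurable_fun_ltr => //.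
elim: n => [|n IH] /=; first exact: measurable_id.
by apply: measurableT_comp IH; exact: measurable_bstep.
Qed.

Definition unif01 (R : realType) : probability _ R := uniform_prob (@ltr01 R).

Lemma unif01_itv (R : realType) (a b : R) : 0 <= a -> a <= b -> b <= 1 ->
  @unif01 R `[a, b[%classic = (b - a)%:E.
Proof.
move=> a0 ab b1.
rewrite /unif01/= /uniform_prob (eq_integral (fun=> 1%:E)); last first.
  move=> x; rewrite inE/= in_itv/= => /andP[ax xb].
  by rewrite /uniform_pdf (le_trans a0 ax) (le_trans (ltW xb) b1) subr0 invr1.
rewrite integral_cst//= mul1e lebesgue_measure_itv/= lte_fin.
case: ltP => [_|ba]; first by rewrite EFinB.
by have -> : a = b by [apply/eqP; rewrite eq_le ab ba]; rewrite subrr.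
Qed.

Section Patterns.
Variables (R : realType) (p : R).
Hypothesis p01 : 0 <= p <= 1.

Definition pat_set (os : seq (option bool)) : set R :=
  `[0, 1[%classic `&`
  \bigcap_i [set x | oapp (eq_op (bit p i x)) true (nth None os i)].

Definition owt (o : option bool) : R := oapp (wt p) 1 o.

Lemma measurable_pat_set os : measurable (pat_set os).
Proof.
apply: measurableI => //; apply: bigcapT_measurable => i.
case: (nth None os i) => [b|] /=; last first.
  by rewrite (_ : [set _ | _] = setT) ?set_true.
rewrite [X in measurable X](_ : _ = setT `&` bit p i @^-1` [set b]).
  exact: measurable_bit.
by rewrite setTI; apply/seteqP; split=> x /= /eqP.
Qed.

Lemma unif01_pat (os : seq (option bool)) (bs : seq bool) :
  @unif01 R (pat_set (map some bs ++ os)) =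
  ((\prod_(b <- bs) wt p b) * \prod_(o <- os) owt o)%:E.
Proof.
elim: os bs => [|o os IH] bs.
  rewrite cats0 big_nil mulr1.
  have [a [a0 a1 h]] := prefix_itv p01 bs.
  have l0 : 0 <= \prod_(b <- bs) wt p b.
    by case/andP: p01 => ? ?; apply: prodr_ge0 => -[] _; rewrite /wt ?subr_ge0.
  rewrite (_ : pat_set _ = `[a, a + \prod_(b <- bs) wt p b[%classic); last first.
    apply/seteqP; split=> x.
      move=> [/= x01 hx]; rewrite in_itv/=; apply/h; rewrite in_itv/= in x01.
      split=> // i ib; move: (hx i I) => /=.
      by rewrite (nth_map false)//= => /eqP.
    rewrite /= in_itv/= => /h[x01 hx]; split; first by rewrite /= in_itv.
    move=> i _ /=; case: (ltnP i (size bs)) => ib.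
      by rewrite (nth_map false)//= hx.
    by rewrite nth_default// size_map.
  by rewrite unif01_itv// ?lerDl// addrAC subrr add0r.
have catE b : map some (rcons bs b) ++ os = map some bs ++ Some b :: os.
  by rewrite map_rcons cat_rcons.
case: o => [b|]; first by rewrite -catE IH big_rcons/= big_cons mulrA.
rewrite (_ : pat_set _ = pat_set (map some (rcons bs true) ++ os) `|`
                         pat_set (map some (rcons bs false) ++ os)).
  transitivity (unif01 R (pat_set (map some (rcons bs true) ++ os)) +
                unif01 R (pat_set (map some (rcons bs false) ++ os)))%E.
    apply: measureU; [exact: measurable_pat_set|exact: measurable_pat_set|].
    apply/seteqP; split=> // x [[_ /(_ (size bs) I)] + [_ /(_ (size bs) I)]] /=.
    by rewrite !catE !nth_cat !size_map ltnn subnn /= => /eqP->.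
  by rewrite !IH !big_rcons/= big_cons/= -EFinD mul1r; congr EFin; rewrite /wt; ring.
have nthE o i : i != size bs -> nth None (map some bs ++ o :: os) i =
    nth None (map some bs ++ None :: os) i.
  rewrite !nth_cat size_map; case: ltngtP => // ib _.
  by rewrite -(subnSK ib).
apply/seteqP; split=> x.
  move=> [x01 hx]; case e: (bit p (size bs) x); [left|right]; split => // i _ /=;
  rewrite catE; have [->|ib] := eqVneq i (size bs);
  by [rewrite nth_cat size_map ltnn subnn /= e|rewrite nthE//; exact: hx].
move=> [|] [x01 hx]; split=> // i _ /=; (have [->|ib] := eqVneq i (size bs);
  first by rewrite nth_cat size_map ltnn subnn);
  by move: (hx i I); rewrite /= catE nthE.
Qed.

End Patterns.

Section MainExistence.
Variables (R : realType) (E : choiceType).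

Definition bits (p : R) (idx : E -> nat) : measurableTypeR R -> config E :=
  fun x e => bit p (idx e) x.

Lemma measurable_bits (p : R) (idx : E -> nat) :
  measurable_fun setT (bits p idx).
Proof.
apply: (@measurability _ _ _ (config E) setT _ (@open_cylinders E)) => // _ [_ [e _ <-] <-].
rewrite [X in measurable X](_ : _ = setT `&` bit p (idx e) @^-1` [set true]) //.
exact: measurable_bit.
Qed.

HB.instance Definition _ (p : R) (idx : E -> nat) :=
  isMeasurableFun.Build _ _ _ _ (bits p idx) (measurable_bits p idx).

Lemma bernoulli_exists (p : R) : countable [set: E] -> 0 <= p <= 1 ->
  exists P : probability (config E) R, is_bernoulli p P.
Proof.
move=> /countable_injP[idx idx_inj] p01.
have {}idx_inj : injective idx by move=> x y; apply: idx_inj; rewrite inE.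
exists (distribution (unif01 R) (bits p idx)).
move=> s t us; rewrite /distribution/pushforward.
pose N := \max_(e <- s) (idx e).+1.
pose pat i := ohead [seq t e | e <- s & idx e == i].
have ltN e : e \in s -> (idx e < N)%N.
  by move=> es; rewrite /N (big_rem _ es)/= leq_max leqnn.
have filt1 e : e \in s -> [seq e' <- s | idx e' == idx e] = [:: e].
  move=> es; rewrite (eq_filter (a2 := pred1 e)); first exact: filter_pred1_uniq.
  by move=> e' /=; rewrite (inj_eq idx_inj).
have patE i : (i < N)%N -> nth None (mkseq pat N) i = pat i by move=> ?; rewrite nth_mkseq.
have /esym H := unif01_pat p01 (mkseq pat N) [::].
rewrite big_nil mul1r in H.
transitivity (unif01 R (pat_set p (mkseq pat N))).
  pose A : set R := [set x | forall e, e \in s -> bit p (idx e) x = t e].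
  transitivity (unif01 R A); first by [].
  have AE : A `&` `[0, 1[%classic = pat_set p (mkseq pat N).
    apply/seteqP; split=> x [].
      move=> hx x01; split=> //.
      move=> i _ /=; case: (ltnP i N) => iN; last by rewrite nth_default ?size_mkseq.
      rewrite patE// /pat; case E1 : [seq _ <- _ | _] => [//|e l] /=.
      have : e \in [seq e <- s | idx e == i] by rewrite E1 mem_head.
      by rewrite mem_filter => /andP[/eqP<- es]; rewrite hx.
    move=> x01 hx; split=> // e es; move: (hx (idx e) I); rewrite /= patE ?ltN//.
    by rewrite /pat filt1//= => /eqP.
  have mI : measurable (`[0, 1[%classic : set R) by [].
  have mA : measurable A.
    rewrite (_ : A = \bigcap_(e in [set` s]) (bit p (idx e) @^-1` [set t e])).
      apply: fin_bigcap_measurable => // e _.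
      by rewrite -[X in measurable X]setTI; exact: measurable_bit.
    by apply/seteqP; split=> x /= h e es; exact: h.
  rewrite (measureDI (unif01 R) mA mI) AE.
  rewrite [X in (X + _)%E](_ : _ = 0%E) ?add0e//.
  apply/eqP; rewrite eq_le measure_ge0 andbT.
  apply: (@le_trans _ _ (unif01 R (~` `[0, 1[%classic))).
    apply: le_measure; rewrite ?inE; last by move=> x [].
      exact: measurableD.
    exact: measurableC.
  by rewrite probability_setC// unif01_itv// subr0 subee.
rewrite -H; congr EFin; rewrite /mkseq big_map.
have -> : \prod_(e <- s) (if t e then p else 1 - p) =
  \prod_(e <- s) \prod_(i <- iota 0 N) (if idx e == i then wt p (t e) else 1).
  rewrite !big_seq; apply: eq_bigr => e es.
  rewrite -big_mkcond/= (big_rem (idx e)) ?mem_iota ?ltN//= eqxx.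
  rewrite big_seq_cond big1 ?mulr1// => i /andP[+ /eqP ie].
  by rewrite -ie mem_rem_uniqF// iota_uniq.
rewrite exchange_big/=; apply: eq_bigr => i _.
rewrite -big_mkcond/= -big_filter /pat.
case E1 : [seq _ <- _ | _] => [|e l] /=; first by rewrite big_nil.
have : e \in [seq e <- s | idx e == i] by rewrite E1 mem_head.
rewrite mem_filter => /andP[/eqP ie es].
by move: E1; rewrite -ie filt1// => -[<-]; rewrite big_seq1.
Qed.

Lemma bernoulliP (p : R) : countable [set: E] -> 0 <= p <= 1 ->
  is_bernoulli p (bernoulli E p).
Proof. by move=> cE p01; apply: getPex; exact: bernoulli_exists. Qed.

Lemma bernoulli_unique (p : R) (P Q : probability (config E) R) :
  is_bernoulli p P -> is_bernoulli p Q ->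
  forall A, measurable A -> P A = Q A.
Proof.
move=> hP hQ.
pose cyl (s : seq E) : set (config E) := [set w | forall e, e \in s -> w e = true].
have mc s : measurable (cyl s).
  rewrite (_ : cyl s = \bigcap_(e in [set` s]) [set w : E -> bool | w e]).
    apply: fin_bigcap_measurable.
      exact: finite_seq.
    by move=> e _; apply: sub_sigma_algebra; exists e.
  by apply/seteqP; split=> w /= h e es; exact: h.
apply: (measure_unique (range cyl) (fun=> setT)).
- apply/seteqP; split.
    apply: smallest_sub; first exact: smallest_sigma_algebra.
    move=> _ [e _ <-]; apply: sub_sigma_algebra; exists [:: e] => //.
    apply/seteqP; split=> w /=; first by move=> /(_ e (mem_head _ _)).
    by move=> we e'; rewrite inE => /eqP->.
  apply: smallest_sub; first exact: sigma_algebra_measurable.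
  by move=> _ [s _ <-]; exact: mc.
- move=> _ _ [s _ <-] [s' _ <-]; exists (s ++ s') => //.
  apply/seteqP; split=> w /=.
    by move=> h; split=> e es; apply: h; rewrite mem_cat es ?orbT.
  by move=> [h h'] e; rewrite mem_cat => /orP[/h|/h'].
- by move=> _; exists [::] => //; apply/seteqP; split.
- by rewrite bigcup_const.
- move=> _ [s _ <-].
  have -> : cyl s = [set w : E -> bool | forall e, e \in undup s -> w e = true].
    by apply/seteqP; split=> w /= h e; have := h e; rewrite mem_undup.
  exact: etrans (hP _ _ (undup_uniq s)) (esym (hQ _ _ (undup_uniq s))).
- by move=> _ /=; rewrite probability_setT ltry.
Qed.

End MainExistence.

Section Countability.
Variables (G : groupType) (S : set G).
Hypotheses (finS : finite_set S) (genS : generates S).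

Lemma group_countable : countable [set: G].
Proof.
have /finite_seqP[s Ss] := finS.
pose letter (ib : nat * bool) : G :=
  if ib.2 then (nth 1 s ib.1)%g else (nth 1 s ib.1)^-1%g.
pose word (w : seq (nat * bool)) : G := (\prod_(ib <- w) letter ib)%g.
have wordV w : word [seq (ib.1, ~~ ib.2) | ib <- rev w] = (word w)^-1%g.
  elim: w => [|[i b] w IH]; first by rewrite /word !big_nil invg1.
  rewrite rev_cons map_rcons /word big_rcons big_cons invgM -/(word _) IH.
  by rewrite /letter /=; case: b; rewrite //= invgK.
suff <- : range word = setT by apply: sub_countable (card_image_le _ _) _.
apply: genS.
  split; first by rewrite inE; exists [::] => //; rewrite /word big_nil.
  move=> _ _ /[!inE] -[u _ <-] [v _ <-].
  exists (u ++ [seq (ib.1, ~~ ib.2) | ib <- rev v]) => //.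
  by rewrite -wordV /word big_cat.
move=> x; rewrite Ss /= => xs; exists [:: (index x s, true)] => //.
by rewrite /word big_seq1 /letter /= nth_index.
Qed.

Lemma edge_countable : countable [set: edge S].
Proof.
have cE : countable (cayley_edges S).
  apply: (@sub_countable _ _ _ (range (fun uv : G * G => [set uv.1; uv.2]))).
    by apply: subset_card_le => _ [u [v [_ ->]]]; exists (u, v).
  apply: sub_countable (card_image_le _ _) _.
  by rewrite -setXTT; apply: countableX; exact: group_countable.
have /countable_injP[f finj] := cE.
apply/countable_injP; exists (fun e => f (val e)) => e e' _ _ /finj h.
by apply: val_inj; apply: h; rewrite inE; exact: set_valP.
Qed.

Lemma percolationP (R : realType) (p : R) : 0 <= p <= 1 ->
  is_bernoulli p (bernoulli (edge S) p).
Proof. by apply: bernoulliP; exact: edge_countable. Qed.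

End Countability.

(* Main.v *)
Require Import Defs.
From mathcomp Require Import all_boot all_order all_algebra.
From mathcomp Require Import all_classical all_reals all_analysis.
From HB Require Import structures.
From mathcomp Require Import ring lra.

Set Implicit Arguments.
Unset Strict Implicit.
Unset Printing Implicit Defensive.
Import Order.TTheory GRing.Theory Num.Theory.

Local Open Scope classical_set_scope.
Local Open Scope ring_scope.

(** The two implications are of unequal depth.  Write [H1], [H2] for the two
    subgroups, and call a cluster [A]-infinite when it meets [A] infinitely often.

    From [H2] to [H1].  The points of [H1] are equally likely to lie in the
    [H2]-infinite cluster, so with positive probability, hence almost surely by
    ergodicity of the translations by [H1], infinitely many of them do
    ([unique_sub]).

    From [H1] to [H2].  Let [K] be the [H1]-infinite cluster and let [I] be the
    subgroup of those [g] in [H2] such that [K] is almost surely the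
    [g H1]-infinite cluster as well; then [K] is an [I]-equivariant cluster.  The
    main step, [distinguished_dominates], says that an [L]-equivariant cluster
    which almost surely exists and is unique contains every [L]-infinite cluster;
    hence [K] is the unique [I]-infinite cluster.  If [I] were not [H2],
    wq-normality would give [g] in [H2] outside [I] with [J], the intersection
    of [I] and [g I g^-1], infinite.  The translate of [K] by [g] is
    [J]-equivariant, so, as before, it is [J]-infinite almost surely; thus it is
    [I]-infinite and equal to [K], that is, [g] belongs to [I]: a contradiction
    ([unique_wq_normal]).  At the parameters [0] and [1] both sides are decided
    separately.

    The main step is a form of indistinguishability of infinite clusters, and is
    proved by mass transport and finite modifications only.  If some other
    cluster were [L]-infinite, finitely many openings would attach it to [K] by
    one edge [e0], so that with positive probability a translate of [e0] is a
    bridge: an open edge whose closing splits off from [K] a branch that is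
    still [L]-infinite.  Let each point of [L] send mass to the nearest bridge
    above it, and each bridge to its parent, the nearest bridge above it.
    In expectation, as much mass is received as is sent.  Hence each bridge is
    nearest to finitely many points only; its branch being infinite, it must have
    a child; and since a bridge sends mass at most once, it has exactly one child
    and one parent ([regular_ae]).  So the bridges form bi-infinite chains that
    cut [K] into pieces finite in [L], and a branch cannot have two infinite
    parts that are separated by closing one more edge.  But attaching by [e0] an
    [L]-infinite cluster to a point of [K], which lies in some branch, produces
    just that ([no_attachment]). *)

(** * Events and null sets *)

Section Events.
Context d (T : measurableType d) (R : realType).

Lemma event_ex (I : Type) (Phi : I -> T -> Prop) : countable [set: I] ->
  (forall i, measurable [set w | Phi i w]) ->
  measurable [set w | exists i, Phi i w].
Proof.
move=> /countable_injP[f finj] mPhi.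
rewrite (_ : [set w | _] =
    \bigcup_n [set w | exists2 i, f i = n & Phi i w]); last first.
  apply/seteqP; split=> w /=; first by move=> [i Pi]; exists (f i) => //; exists i.
  by move=> [n _ [i _ Pi]]; exists i.
apply: bigcupT_measurable => n.
have [[i fi]|ni] := pselect (exists i, f i = n).
  rewrite (_ : [set w | _] = [set w | Phi i w])//.
  apply/seteqP; split=> w /=; last by exists i.
  by move=> [j fj]; rewrite (_ : j = i)//; apply: finj; rewrite ?inE// fi.
rewrite (_ : [set w | _] = set0)//; apply/seteqP; split=> w //= [i fi _].
by apply: ni; exists i.
Qed.

Lemma event_not (Phi : T -> Prop) :
  measurable [set w | Phi w] -> measurable [set w | ~ Phi w].
Proof. exact: measurableC. Qed.

Lemma event_and (Phi Psi : T -> Prop) :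
  measurable [set w | Phi w] -> measurable [set w | Psi w] ->
  measurable [set w | Phi w /\ Psi w].
Proof. exact: measurableI. Qed.

Lemma event_all (I : Type) (Phi : I -> T -> Prop) : countable [set: I] ->
  (forall i, measurable [set w | Phi i w]) ->
  measurable [set w | forall i, Phi i w].
Proof.
move=> cI mPhi; rewrite (_ : [set w | _] = ~` [set w | exists i, ~ Phi i w]).
  by apply: measurableC; apply: event_ex => // i; exact: event_not.
apply/seteqP; split=> w /=; first by move=> h [i]; apply.
by move=> h i; apply: contrapT => ni; apply: h; exists i.
Qed.

Lemma event_imp (Phi Psi : T -> Prop) :
  measurable [set w | Phi w] -> measurable [set w | Psi w] ->
  measurable [set w | Phi w -> Psi w].
Proof.
move=> mPhi mPsi; rewrite (_ : [set w | _] = ~` [set w | Phi w] `|` [set w | Psi w]).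
  by apply: measurableU => //; exact: measurableC.
apply/seteqP; split=> w /=.
  by have [/[swap]/[apply]|] := pselect (Phi w); [right|left].
by move=> [|].
Qed.

Lemma event_iff (Phi Psi : T -> Prop) :
  measurable [set w | Phi w] -> measurable [set w | Psi w] ->
  measurable [set w | Phi w <-> Psi w].
Proof. by move=> ? ?; apply: event_and; apply: event_imp. Qed.

Lemma event_prop (Q : Prop) : measurable [set _ : T | Q].
Proof.
have [q|nq] := pselect Q.
  by rewrite (_ : [set _ | _] = setT)//; apply/seteqP; split.
by rewrite (_ : [set _ | _] = set0)//; apply/seteqP; split.
Qed.

Lemma ae_all (mu : {measure set T -> \bar R}) (I : Type) (Phi : I -> T -> Prop) :
  countable [set: I] -> (forall i, {ae mu, forall w, Phi i w}) ->
  {ae mu, forall w i, Phi i w}.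
Proof.
move=> /countable_injP[f finj] aPhi.
have : {ae mu, forall w, forall n i, f i = n -> Phi i w}.
  apply: ae_foralln => n.
  have [[i fi]|ni] := pselect (exists i, f i = n).
    apply: filterS (aPhi i) => w Pi j fj.
    by rewrite (_ : j = i)//; apply: finj; rewrite ?inE// fi.
  by apply: aeW => w i fi; case: ni; exists i.
by apply: filterS => w h i; exact: h.
Qed.

Lemma ae_and (mu : {measure set T -> \bar R}) (Phi Psi : T -> Prop) :
  {ae mu, forall w, Phi w} -> {ae mu, forall w, Psi w} ->
  {ae mu, forall w, Phi w /\ Psi w}.
Proof. exact: filterI. Qed.

Lemma ae_imp (mu : {measure set T -> \bar R}) (Phi Psi : T -> Prop) :
  (forall w, Phi w -> Psi w) ->
  {ae mu, forall w, Phi w} -> {ae mu, forall w, Psi w}.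
Proof. exact: filterS. Qed.

(** Replaces a random object with some property by a deterministic one that has
    the property with positive probability. *)
Lemma nonnull_ex (mu : {measure set T -> \bar R}) (I : Type)
    (Phi : I -> T -> Prop) : countable [set: I] ->
  ~ mu.-negligible [set w | exists i, Phi i w] ->
  exists i, ~ mu.-negligible [set w | Phi i w].
Proof.
move=> cI h; apply: contrapT => nex; apply: h.
have : {ae mu, forall w i, ~ Phi i w}.
  apply: ae_all => // i; have : mu.-negligible [set w | Phi i w].
    by apply: contrapT => ni; apply: nex; exists i.
  by apply: negligibleS => w /= /contrapT.
by apply: negligibleS => w /= [i Pi] /(_ i).
Qed.

Lemma nonnull_ae (mu : {measure set T -> \bar R}) (Phi Psi : T -> Prop) :
  ~ mu.-negligible [set w | Phi w] -> {ae mu, forall w, Psi w} ->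
  ~ mu.-negligible [set w | Phi w /\ Psi w].
Proof.
move=> h aPsi n; apply: h.
apply: negligibleS (negligibleU n aPsi) => w /= Pw.
by have [|] := pselect (Psi w); [left|right].
Qed.

Lemma nonnull_point (mu : {measure set T -> \bar R}) (Phi : T -> Prop) :
  ~ mu.-negligible [set w | Phi w] -> exists w, Phi w.
Proof.
move=> h; apply: contrapT => nex; apply: h.
rewrite (_ : [set w | _] = set0); first exact: negligible_set0.
by apply/seteqP; split=> w //= Pw; apply: nex; exists w.
Qed.

Lemma nonnullS (mu : {measure set T -> \bar R}) (Phi Psi : T -> Prop) :
  (forall w, Phi w -> Psi w) ->
  ~ mu.-negligible [set w | Phi w] -> ~ mu.-negligible [set w | Psi w].
Proof. by move=> PP h n; apply: h; apply: negligibleS n => w /=; exact: PP. Qed.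

End Events.

(** * Resampling one edge *)

Section Resampling.
Variables (R : realType) (E : choiceType).
Implicit Types (w : config E) (e : E).

Definition upd w e (b : bool) : config E := fun e' => if e' == e then b else w e'.

Lemma updE w e b : upd w e b e = b.
Proof. by rewrite /upd eqxx. Qed.

Lemma upd_neq w e b e' : e' != e -> upd w e b e' = w e'.
Proof. by rewrite /upd => /negbTE->. Qed.

Lemma upd_id w e : upd w e (w e) = w.
Proof. by apply/funext => e'; rewrite /upd; case: eqVneq => [->|]. Qed.

Lemma upd_upd w e b b' : upd (upd w e b) e b' = upd w e b'.
Proof. by apply/funext => e'; rewrite /upd; case: eqVneq. Qed.

Lemma updC w e b e' b' : e != e' ->
  upd (upd w e b) e' b' = upd (upd w e' b') e b.
Proof.
move=> ee'; apply/funext => f; rewrite /upd.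
by case: (eqVneq f e') => // ->; rewrite eq_sym (negbTE ee').
Qed.

Lemma event_open e : measurable [set w : config E | w e].
Proof. by apply: sub_sigma_algebra; exists e. Qed.

Lemma measurable_config_map (f : config E -> config E) :
  (forall e, measurable [set w | f w e]) -> measurable_fun setT f.
Proof.
move=> mf; apply: (@measurability _ _ _ (config E) setT _ (@open_cylinders E)) => //.
by move=> _ [_ [e _ <-] <-]; rewrite setTI; exact: mf.
Qed.

Lemma measurable_upd e b : measurable_fun setT (fun w => upd w e b).
Proof.
apply: measurable_config_map => e'; rewrite /upd.
by case: eqP => _; [exact: event_prop|exact: event_open].
Qed.

Lemma measurable_updP e b (Phi : config E -> Prop) :
  measurable [set w | Phi w] -> measurable [set w | Phi (upd w e b)].
Proof.
by move=> m; rewrite -[X in measurable X]setTI; exact: (@measurable_upd e b).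
Qed.

Variables (p : R) (p01 : 0 <= p <= 1) (P : probability (config E) R).
Hypothesis hP : is_bernoulli p P.

(** Given all the other edges, [e] is open with probability [p]: the mixture on
    the right is again a Bernoulli measure, and there is only one. *)
Lemma resample e (A : set (config E)) : measurable A ->
  (P A = p%:E * P [set w | A (upd w e true)] +
         (1 - p)%:E * P [set w | A (upd w e false)])%E.
Proof.
move=> mA; have /andP[p0 p1] := p01.
have q0 : 0 <= 1 - p by rewrite subr_ge0.
pose up b : {mfun (config E) >-> (config E)} :=
  HB.pack (fun w : config E => upd w e b)
    (isMeasurableFun.Build _ _ _ _ _ (@measurable_upd e b)).
pose m : {measure set (config E) -> \bar R} :=
  measure_add (mscale (NngNum p0) (distribution P (up true)))
              (mscale (NngNum q0) (distribution P (up false))).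
have mE B : m B = (p%:E * P [set w | B (upd w e true)] +
                   (1 - p)%:E * P [set w | B (upd w e false)])%E.
  by rewrite /m /measure_add/= /msum big_ord_recl big_ord1.
have m1 : m setT = 1%E.
  have PT b : P [set w | [set: config E] (upd w e b)] = 1%E.
    exact: probability_setT.
  by rewrite mE !PT !mule1 -EFinD addrC subrK.
pose Q : probability (config E) R :=
  HB.pack (Measure.sort m) m (Measure_isProbability.Build _ _ _ m m1).
have hQ : is_bernoulli p Q.
  move=> s t us; transitivity (m [set w : config E | forall e, e \in s -> w e = t e]) => //.
  rewrite mE.
  have updP b : P [set w : config E | forall e', e' \in s -> upd w e b e' = t e'] =
     (if (e \in s) && (t e != b) then 0 else
       \prod_(e' <- rem e s) (if t e' then p else 1 - p))%:E.
    case: ifPn => [/andP[es tb]|].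
      rewrite (_ : [set _ | _] = set0) ?measure0//.
      apply/seteqP; split=> w //= /(_ e es); rewrite updE => bt.
      by rewrite bt eqxx in tb.
    move=> h; rewrite -hP ?rem_uniq//; congr (P _).
    apply/seteqP; split=> w /= hw e'.
      rewrite mem_rem_uniq// inE => /andP[e'e e's].
      by rewrite -(hw _ e's) upd_neq.
    move=> e's; have [ee|ne] := eqVneq e' e.
      rewrite ee updE; move: h; rewrite -ee e's/= negbK ee => /eqP <-.
      by [].
    by rewrite upd_neq//; apply: hw; rewrite mem_rem_uniq// inE ne.
  rewrite !updP -!EFinM -EFinD; congr EFin.
  have [es|nes] := boolP (e \in s); last first.
    by rewrite /= rem_id// -mulrDl addrC subrK mul1r.
  rewrite (big_rem e es)/=; case: (t e) => /=.
    by rewrite mulr0 addr0.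
  by rewrite mulr0 add0r.
by rewrite (bernoulli_unique hP hQ mA); exact: mE.
Qed.

End Resampling.

(** * Independence and the zero-one law *)

Section ZeroOne.
Variables (R : realType) (E : choiceType).
Variables (p : R) (p01 : 0 <= p <= 1) (P : probability (config E) R).
Hypothesis hP : is_bernoulli p P.
Implicit Types (w : config E) (e : E) (s : seq E) (A B : set (config E)).

(** Insertion and deletion tolerance: in the total probability formula, both
    terms must vanish, and that of [b] has a positive weight. *)
Lemma null_upd e b A : (if b then 0 < p else p < 1) ->
  P.-negligible A -> P.-negligible [set w | A (upd w e b)].
Proof.
move=> pb [B [mB B0 AB]]; exists [set w | B (upd w e b)]; split.
- exact: measurable_updP.
- have := resample p01 hP e mB; rewrite B0 => /esym/eqP.
  have /andP[p0 p1] := p01.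
  rewrite padde_eq0 ?mule_ge0 ?lee_fin ?subr_ge0// !mule_eq0 !eqe subr_eq0.
  move=> /andP[]; case: b pb {AB} => [pp /orP[/eqP h|/eqP//] _|pp _ /orP[/eqP h|/eqP//]].
  + by rewrite h ltxx in pp.
  + by rewrite -h ltxx in pp.
- by move=> w /= /AB.
Qed.

Lemma ae_upd e b (Phi : config E -> Prop) : (if b then 0 < p else p < 1) ->
  {ae P, forall w, Phi w} -> {ae P, forall w, Phi (upd w e b)}.
Proof. exact: null_upd. Qed.

Definition determined_by s A := forall w w' : config E,
  {in s, w =1 w'} -> A w -> A w'.

(** The edges on which [A] depends are resampled one after the other, which does
    not affect [B]. *)
Lemma independent_sets s A B : measurable A -> determined_by s A ->
  measurable B -> (forall w e b, e \in s -> B (upd w e b) <-> B w) ->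
  P (A `&` B) = (P A * P B)%E.
Proof.
move=> + + mB; elim: s A => [|e s IH] A mA dA hB.
  have [->|/set0P[w0 Aw0]] := eqVneq A set0; first by rewrite set0I measure0 mul0e.
  have -> : A = setT by apply/seteqP; split=> // w _; exact: dA Aw0.
  by rewrite setTI probability_setT mul1e.
have IH' b : P ([set w | A (upd w e b)] `&` B) = (P [set w | A (upd w e b)] * P B)%E.
  apply: IH.
  - exact: measurable_updP.
  - move=> w w' ww'; apply: dA => e'; rewrite inE.
    have [->|ne] := eqVneq e' e; first by rewrite !updE.
    by rewrite !upd_neq//=; exact: ww'.
  - by move=> w e' b' e's; apply: hB; rewrite inE e's orbT.
rewrite (resample p01 hP e (measurableI _ _ mA mB)) (resample p01 hP e mA).
have E1 b : [set w | (A `&` B) (upd w e b)] = [set w | A (upd w e b)] `&` B.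
  by apply/seteqP; split=> w [h /(hB w e b (mem_head _ _))].
rewrite !E1 !IH' !muleA ge0_muleDl// mule_ge0 ?lee_fin ?subr_ge0//;
  by case/andP: p01.
Qed.

Let sd A B := (A `\` B) `|` (B `\` A).

Let approx A := measurable A /\ forall eps : R, 0 < eps ->
  exists s B, [/\ measurable B, determined_by s B & (P (sd A B) <= eps%:E)%E].

Let msd A B : measurable A -> measurable B -> measurable (sd A B).
Proof. by move=> mA mB; apply: measurableU; exact: measurableD. Qed.

Let approxU A B : approx A -> approx B -> approx (A `|` B).
Proof.
move=> [mA hA] [mB hB]; split; first exact: measurableU.
move=> eps eps0; have e20 : 0 < eps / 2 by rewrite divr_gt0.
have [s [A' [mA' dA' AA']]] := hA _ e20.
have [t [B' [mB' dB' BB']]] := hB _ e20.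
exists (s ++ t), (A' `|` B'); split; first exact: measurableU.
  move=> w w' ww' [h|h]; [left; apply: dA' h|right; apply: dB' h] => e es;
  by apply: ww'; rewrite mem_cat es ?orbT.
rewrite [eps]splitr EFinD; apply: le_trans (leeD AA' BB').
apply: le_trans (measureU2 _ _ _); rewrite ?le_measure ?inE//=; try exact: msd.
- by apply: msd; exact: measurableU.
- by apply: measurableU; exact: msd.
- move=> w [[[Aw|Bw] /not_orP[? ?]]|[[Aw|Bw] /not_orP[? ?]]];
  by [left; left|right; left|left; right|right; right].
Qed.

(** Events that are approximable by events depending on finitely many edges form
    a sigma-algebra. *)
Lemma finitary_approximation A : measurable A -> approx A.
Proof.
move=> mA.
have : (@open_cylinders E).-sigma.-measurable `<=` approx.
  apply: smallest_sub => [|_ [e _ <-]]; last first.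
    split=> [|eps eps0]; first exact: event_open.
    exists [:: e], [set w : E -> bool | w e]; split; first exact: event_open.
      by move=> w w' /(_ e (mem_head _ _)) /= <-.
    by rewrite /sd setDv setU0 measure0 lee_fin ltW.
  split.
  - split=> // eps eps0; exists [::], set0; split=> //.
    by rewrite /sd setD0 setU0 measure0 lee_fin ltW.
  - move=> B [mB hB]; rewrite setTD; split; first exact: measurableC.
    move=> eps /hB[s [B' [mB' dB' BB']]]; exists s, (~` B'); split.
    + exact: measurableC.
    + by move=> w w' ww' nB Bw'; apply: nB; apply: dB' Bw' => e es; rewrite ww'.
    + by rewrite /sd !setDE !setCK setUC [X in X `|` _]setIC [X in _ `|` X]setIC -!setDE.
  - move=> F0 hF; pose F : (set (config E))^nat := F0; change (approx (\bigcup_n F n)).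
    have mF n : measurable (F n) by case: (hF n).
    have mU : measurable (\bigcup_n F n) by exact: bigcupT_measurable.
    split=> // eps eps0.
    (* A countable union is first truncated to a finite one. *)
    pose U n := \big[setU/set0]_(i < n) F i.
    have aU n : approx (U n).
      rewrite /U; elim: n => [|n IH]; last by rewrite big_ord_recr; exact: approxU.
      rewrite big_ord0; split=> // d d0; exists [::], set0; split=> //.
      by rewrite /sd setD0 setU0 measure0 lee_fin ltW.
    have e20 : 0 < eps / 2 by rewrite divr_gt0.
    have UF n : U n `<=` \bigcup_n F n.
      by rewrite /U -bigcup_mkord; apply: bigcup_sub => i _; exact: bigcup_sup.
    have [n Un] : exists n, (P (\bigcup_n F n `\` U n) <= (eps / 2)%:E)%E.
      have cv : P \o U @ \oo --> P (\bigcup_n U n).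
        apply: nondecreasing_cvg_mu => //.
        - by move=> n; case: (aU n).
        - by apply: bigcupT_measurable => n; case: (aU n).
        - move=> m n mn; apply/subsetPset; rewrite /U -!bigcup_mkord.
          by apply: bigcup_sub => i im; apply: bigcup_sup => //=; exact: leq_trans mn.
      have UU : \bigcup_n U n = \bigcup_n F n.
        apply/seteqP; split; first by apply: bigcup_sub => n _; exact: UF.
        move=> w [n _ Fw]; exists n.+1 => //.
        by rewrite /U big_ord_recr; right.
      rewrite UU in cv.
      have fU A' : measurable A' -> P A' = (fine (P A'))%:E.
        by move=> mA'; rewrite fineK//; exact: fin_num_measure.
      have /fine_cvgP[_ /cvgrPdist_le /(_ _ e20)[n _ hn]] : 
          P \o U @ \oo --> (fine (P (\bigcup_n F n)))%:E by rewrite -fU.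
      have mUn : measurable (U n) by case: (aU n).
      exists n; rewrite measureD ?ltey_eq ?fin_num_measure// setIidr//.
      rewrite [X in (X - _)%E]fU// [X in (_ - X)%E]fU//.
      rewrite -EFinB lee_fin; apply: le_trans (hn n (leqnn _)).
      exact: ler_norm.
    have [s [B [mB dB BU]]] := (aU n).2 _ e20.
    exists s, B; split=> //; rewrite [eps]splitr EFinD.
    apply: le_trans (leeD Un BU).
    have mUn : measurable (U n) by case: (aU n).
    apply: le_trans (measureU2 _ _ _); rewrite ?le_measure ?inE//=.
    + exact: msd.
    + by apply: measurableU; [exact: measurableD|exact: msd].
    + move=> w [[Fw nB]|[Bw nF]].
        by have [Uw|nU] := pselect (U n w); [right; left|left].
      by right; right; split=> // /UF.
    + exact: measurableD.
    + exact: msd.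
by move=> /(_ A); exact.
Qed.

Lemma le_dist_symdiff A B : measurable A -> measurable B ->
  `|fine (P A) - fine (P B)| <= fine (P (sd A B)).
Proof.
move=> mA mB.
have le C D : measurable C -> measurable D ->
    fine (P C) <= fine (P D) + fine (P (sd C D)).
  move=> mC mD; rewrite -fineD; try exact: fin_num_measure.
    apply: fine_le; rewrite ?fin_numD ?fin_num_measure//; try exact: msd.
    apply: le_trans (measureU2 _ _ _); rewrite ?le_measure ?inE//=; try exact: msd.
      by apply: measurableU => //; exact: msd.
    by move=> w Cw; have [|] := pselect (D w); [left|right; left].
  by apply: fin_num_measure; exact: msd.
have sdC : sd A B = sd B A by rewrite /sd setUC.
have := le _ _ mA mB; have := le _ _ mB mA; rewrite -sdC ler_norml; lra.
Qed.

Definition relabel (f : E -> E) w : config E := fun e => w (f e).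

Lemma measurable_relabel (f : E -> E) : measurable_fun setT (relabel f).
Proof. by apply: measurable_config_map => e; exact: event_open. Qed.

Lemma measurable_relabelP (f : E -> E) A :
  measurable A -> measurable [set w | A (relabel f w)].
Proof. by move=> mA; rewrite -[X in measurable X]setTI; exact: measurable_relabel. Qed.

Lemma relabel_invariant (f g : E -> E) A : cancel f g -> measurable A ->
  P [set w | A (relabel f w)] = P A.
Proof.
move=> fg mA.
pose X : {mfun (config E) >-> (config E)} :=
  HB.pack (relabel f) (isMeasurableFun.Build _ _ _ _ _ (measurable_relabel f)).
suff hQ : is_bernoulli p (distribution P X) by exact: esym (bernoulli_unique hP hQ mA).
move=> s t us; rewrite /distribution /pushforward.
have := hP (t \o g) (s := map f s).
rewrite map_inj_uniq; last exact: can_inj fg.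
move=> /(_ us); rewrite big_map /=; under eq_bigr do rewrite fg.
move=> <-; congr (P _); apply/seteqP; split=> w /= h.
  by move=> _ /mapP[e es ->]; rewrite fg -h.
by move=> e es; rewrite /relabel h ?map_f//= fg.
Qed.

Lemma null_relabel (f g : E -> E) A : cancel f g ->
  P.-negligible A -> P.-negligible [set w | A (relabel f w)].
Proof.
move=> fg [B [mB B0 AB]]; exists [set w | B (relabel f w)]; split.
- exact: measurable_relabelP.
- by rewrite (relabel_invariant fg).
- by move=> w /AB.
Qed.

(** Approximate [A] by an event depending on a finite set of edges.  Moving
    these edges off themselves makes [A] nearly independent of itself, so that
    its probability is equal to its square. *)
Lemma zero_one A : measurable A ->
  (forall s, exists f g : E -> E, [/\ cancel f g,
     forall w, A (relabel f w) <-> A w & {in s, forall e, f e \notin s}]) ->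
  P.-negligible A \/ P.-negligible (~` A).
Proof.
move=> mA hA; pose a := fine (P A).
have PA : P A = a%:E by rewrite fineK// fin_num_measure.
have a01 : 0 <= a <= 1.
  by rewrite -!lee_fin -PA measure_ge0 probability_le1.
suff /eqP : a * (1 - a) = 0.
  rewrite mulf_eq0 subr_eq0 => /orP[/eqP h|/eqP h]; [left; exists A|right; exists (~` A)].
    by split=> //; rewrite PA h.
  split=> //; first exact: measurableC.
  by rewrite probability_setC// PA -h subee.
apply/eqP; rewrite -normr_le0; apply/ler_addgt0Pl => eps eps0; rewrite addr0.
have e40 : 0 < eps / 4 by rewrite divr_gt0.
have [s [B [mB dB AB]]] := (finitary_approximation mA).2 _ e40.
have [f [g [fg fA fs]]] := hA s.
pose B' := [set w | B (relabel f w)].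
have mB' : measurable B' by exact: measurable_relabelP.
pose b := fine (P B).
have PB : P B = b%:E by rewrite fineK// fin_num_measure.
have b01 : 0 <= b <= 1 by rewrite -!lee_fin -PB measure_ge0 probability_le1.
have fAB : fine (P (sd A B)) <= eps / 4.
  by rewrite -lee_fin fineK// fin_num_measure//; exact: msd.
have ab : `|a - b| <= eps / 4 by apply: le_trans fAB; exact: le_dist_symdiff.
have PBB : P (B `&` B') = (b * b)%:E.
  rewrite (independent_sets mB dB mB').
    by rewrite (relabel_invariant fg mB) PB EFinM.
  move=> w e c es; rewrite /B' /=.
  have ee e' : e' \in s -> relabel f (upd w e c) e' = relabel f w e'.
    move=> e's; rewrite /relabel upd_neq//; apply/eqP => fe.
    by move/negP: (fs _ e's); apply; rewrite fe.
  by split; apply: dB => e' /ee.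
have abb : `|a - b * b| <= eps / 4 + eps / 4.
  rewrite -[b * b]/(fine (b * b)%:E) -PBB.
  apply: le_trans (le_dist_symdiff mA (measurableI _ _ mB mB')) _.
  rewrite -lee_fin fineK; last first.
    by apply: fin_num_measure; apply: msd => //; exact: measurableI.
  rewrite EFinD.
  have AB2 : (P [set w | sd A B (relabel f w)] <= (eps / 4)%:E)%E.
    by rewrite (relabel_invariant fg)//; exact: msd.
  apply: le_trans (leeD AB AB2).
  apply: le_trans (measureU2 _ _ _); rewrite ?le_measure ?inE//=.
  - by apply: msd => //; exact: measurableI.
  - by apply: measurableU; [exact: msd|apply: measurable_relabelP; exact: msd].
  - move=> w [[Aw /not_andP[nB|nB]]|[[Bw Bw'] nA]].
    + by left; left.
    + by right; left; split=> //; apply/fA.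
    + by left; right.
  - exact: msd.
  - by apply: measurable_relabelP; exact: msd.
have bb : `|b * b - a * a| <= eps / 4 + eps / 4.
  rewrite (_ : b * b - a * a = (b - a) * (b + a)); last by ring.
  rewrite normrM distrC.
  have : `|b + a| <= 2 by rewrite ger0_norm; lra.
  move: ab (normr_ge0 (a - b)) (normr_ge0 (b + a)); nra.
rewrite (_ : a * (1 - a) = (a - b * b) + (b * b - a * a)); last by ring.
apply: le_trans (ler_normD _ _) _; lra.
Qed.

End ZeroOne.

(** * Subgroups and their cosets *)

Section SubgroupTheory.
Variable G : groupType.
Implicit Types (H : set G) (g x y : G).

Lemma subgroup1 H : subgroup H -> H 1%g.
Proof. by case=> /set_mem. Qed.

Lemma subgroup_div H x y : subgroup H -> H x -> H y -> H (x * y^-1)%g.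
Proof. by case=> _ h Hx Hy; apply/set_mem/h; exact: mem_set. Qed.

Lemma subgroupV H x : subgroup H -> H x -> H (x^-1)%g.
Proof. by move=> sH Hx; rewrite -[x^-1%g]mul1g; exact: (subgroup_div sH (subgroup1 sH) Hx). Qed.

Lemma subgroupM H x y : subgroup H -> H x -> H y -> H (x * y)%g.
Proof. by move=> sH Hx Hy; rewrite -[y]invgK; exact: (subgroup_div sH Hx (subgroupV sH Hy)). Qed.

Lemma subgroupP H : H 1%g -> (forall x y, H x -> H y -> H (x * y^-1)%g) -> subgroup H.
Proof.
by move=> H1 HM; split=> [|x y /set_mem Hx /set_mem Hy]; apply/mem_set => //; exact: HM.
Qed.

Definition lcoset_set g H : set G := [set (g * x)%g | x in H].

Lemma lcoset_setP g H x : lcoset_set g H x <-> H (g^-1 * x)%g.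
Proof.
split; first by move=> [y Hy <-]; rewrite mulKg.
by move=> h; exists (g^-1 * x)%g => //; rewrite mulVKg.
Qed.

Lemma lcoset_set_id g H : subgroup H -> H g -> lcoset_set g H = H.
Proof.
move=> sH Hg; apply/seteqP; split=> x.
  by move=> [y Hy <-]; exact: (subgroupM sH Hg Hy).
move=> Hx; apply/lcoset_setP; exact: (subgroupM sH (subgroupV sH Hg) Hx).
Qed.

Lemma lcoset_setM g h H : lcoset_set (g * h)%g H = lcoset_set g (lcoset_set h H).
Proof.
apply/seteqP; split=> [_ [y Hy <-]|_ [_ [y Hy <-] <-]]; last first.
  by exists y => //; rewrite mulgA.
by exists (h * y)%g; [exists y|rewrite mulgA].
Qed.

Lemma lcoset_set1 H : lcoset_set 1%g H = H.
Proof.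
by rewrite /lcoset_set (_ : (fun x => 1 * x)%g = id) ?image_id//; apply/funext => x; rewrite mul1g.
Qed.

Lemma infinite_lcoset_set g H : infinite_set (lcoset_set g H) <-> infinite_set H.
Proof.
suff h k A : infinite_set A -> infinite_set (lcoset_set k A).
  by split=> [/(h g^-1%g)|/(h g)//]; rewrite -lcoset_setM mulVg lcoset_set1.
move=> iA fA; apply: iA.
have : finite_set (lcoset_set k^-1%g (lcoset_set k A)) by exact: finite_image.
by rewrite -lcoset_setM mulVg lcoset_set1.
Qed.

End SubgroupTheory.

(** * The action on edges and configurations *)

Section EdgeAction.
Variables (G : groupType) (S : set G).
Implicit Types (e : edge S) (g u v x y : G) (w : config (edge S)).

Definition joins e u v := val e = [set u; v].

Lemma set2_eq (T : Type) (u v x y : T) :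
  [set u; v] = [set x; y] -> (x = u /\ y = v) \/ (x = v /\ y = u).
Proof.
move=> h.
have hx : [set u; v] x by rewrite h; left.
have hy : [set u; v] y by rewrite h; right.
have hu : [set x; y] u by rewrite -h; left.
have hv : [set x; y] v by rewrite -h; right.
by move: hx hy hu hv => /= [?|?] [?|?] [?|?] [?|?];
  (left; split; congruence) || (right; split; congruence).
Qed.

Lemma joinsC e u v : joins e u v -> joins e v u.
Proof. by rewrite /joins setUC. Qed.

Lemma joins_eq e u v x y : joins e u v -> joins e x y ->
  (x = u /\ y = v) \/ (x = v /\ y = u).
Proof. by move=> h h'; apply: set2_eq; exact: etrans (esym h) h'. Qed.

Lemma joins_inj e e' u v : joins e u v -> joins e' u v -> e = e'.
Proof. by rewrite /joins => h h'; apply: val_inj; rewrite h h'. Qed.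

Lemma edge_joins e : exists u v, joins e u v.
Proof. by have [u [v [_ h]]] := set_valP e; exists u, v. Qed.

Lemma adj_edge u v : cayley_adj S u v -> exists e, joins e u v.
Proof.
move=> a; have h : cayley_edges S [set u; v] by exists u, v.
by exists (exist (fun f : set G => f \in cayley_edges S) _ (mem_set h)).
Qed.

Lemma adj_mul g u v : cayley_adj S u v -> cayley_adj S (g * u)%g (g * v)%g.
Proof.
move=> [uv h]; split; first by rewrite (inj_eq (mulgI g)).
by rewrite !invgM -!mulgA !mulKg.
Qed.

Lemma eact_subproof g e : [set (g * x)%g | x in val e] \in cayley_edges S.
Proof.
apply/mem_set; have [u [v [a ->]]] := set_valP e.
exists (g * u)%g, (g * v)%g; split; first exact: adj_mul.
by rewrite image_setU !image_set1.
Qed.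

Definition eact g e : edge S :=
  exist (fun f : set G => f \in cayley_edges S) _ (eact_subproof g e).

Lemma joins_eact g e u v : joins e u v -> joins (eact g e) (g * u)%g (g * v)%g.
Proof. by rewrite /joins => h; rewrite /= h image_setU !image_set1. Qed.

Lemma eactM g h e : eact (g * h)%g e = eact g (eact h e).
Proof.
have [u [v euv]] := edge_joins e; apply: joins_inj (joins_eact _ euv) _.
by rewrite -!mulgA; do 2!apply: joins_eact.
Qed.

Lemma eact1 e : eact 1%g e = e.
Proof.
have [u [v euv]] := edge_joins e.
by apply: joins_inj (joins_eact _ euv) _; rewrite !mul1g.
Qed.

Lemma eactK g : cancel (eact g) (eact g^-1%g).
Proof. by move=> e; rewrite -eactM mulVg eact1. Qed.

Lemma eactKV g : cancel (eact g^-1%g) (eact g).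
Proof. by move=> e; rewrite -eactM mulgV eact1. Qed.

Definition act g w : config (edge S) := relabel (eact g^-1%g) w.

Lemma actE g w e : act g w (eact g e) = w e.
Proof. by rewrite /act /relabel eactK. Qed.

Lemma act1 w : act 1%g w = w.
Proof. by apply/funext => e; rewrite /act /relabel invg1 eact1. Qed.

Lemma actM g h w : act (g * h)%g w = act g (act h w).
Proof. by apply/funext => e; rewrite /act /relabel invgM eactM. Qed.

Lemma actK g : cancel (act g) (act g^-1%g).
Proof. by move=> w; rewrite -actM mulVg act1. Qed.

Lemma actKV g : cancel (act g^-1%g) (act g).
Proof. by move=> w; rewrite -actM mulgV act1. Qed.

Lemma act_upd g w e b : act g (upd w e b) = upd (act g w) (eact g e) b.
Proof.
apply/funext => f; rewrite /act /relabel /upd.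
by rewrite (can2_eq (eactKV g) (eactK g)).
Qed.

(** At most two elements map one given edge to another one, so only finitely many
    fail to move [s] off itself. *)
Lemma eact_disjoint (J : set G) (s : seq (edge S)) : infinite_set J ->
  exists2 g, J g & {in s, forall e, eact g e \notin s}.
Proof.
move=> iJ; apply: contrapT => nex; apply: iJ.
have fe (e e' : edge S) : finite_set [set g | eact g e = e'].
  have [u [v euv]] := edge_joins e; have [u' [v' euv']] := edge_joins e'.
  apply: (@sub_finite_set _ _ [set (u' * u^-1)%g; (v' * u^-1)%g]); last first.
    by rewrite finite_setU.
  move=> g /= ge; have := joins_eact g euv; rewrite ge.
  by move=> /(joins_eq euv') [[h _]|[h _]]; [left|right]; rewrite -h mulgK.
apply: (@sub_finite_set _ _
    (\bigcup_(e in [set` s]) \bigcup_(e' in [set` s]) [set g | eact g e = e'])).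
  move=> g Jg; apply: contrapT => ng; apply: nex; exists g => // e es.
  by apply/negP => ges; apply: ng; exists e => //; exists (eact g e).
by do 2!(apply: bigcup_finite => [|? _]; first exact: finite_seq).
Qed.

End EdgeAction.

(** * Clusters *)

Section Clusters.
Variables (G : groupType) (S : set G).
Implicit Types (e : edge S) (g u v x y z : G) (w : config (edge S)) (A : set G).

Notation conn w := (connected_in w).

Lemma open_adjC w x y : open_adj w x y -> open_adj w y x.
Proof. by move=> [e h we]; exists e => //; exact: joinsC. Qed.

Lemma connxx w x : conn w x x.
Proof. by exists [::]. Qed.

Lemma conn_step w x y z : conn w x y -> open_adj w y z -> conn w x z.
Proof.
move=> [s ps ->] yz; exists (rcons s z); last by rewrite last_rcons.
by rewrite rcons_path ps; apply/asboolP.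
Qed.

Lemma conn_adj w x y : open_adj w x y -> conn w x y.
Proof. exact/conn_step/connxx. Qed.

Lemma conn_ind w x (Q : G -> Prop) : Q x ->
  (forall y z, conn w x y -> Q y -> open_adj w y z -> Q z) ->
  forall y, conn w x y -> Q y.
Proof.
move=> Qx h y [s ps ->]; elim/last_ind: s ps => // s z IH.
rewrite rcons_path last_rcons => /andP[ps /asboolP a].
by apply: h (IH ps) a; exists s.
Qed.

Lemma conn_trans w x y z : conn w x y -> conn w y z -> conn w x z.
Proof. by move=> xy; elim/conn_ind => // ? ? _; exact: conn_step. Qed.

Lemma connC w x y : conn w x y -> conn w y x.
Proof.
elim/conn_ind=> [|y' z xy yx a]; first exact: connxx.
by apply: conn_trans yx; apply: conn_adj; exact: open_adjC.
Qed.

Definition sub_config w w' := forall e, w e -> w' e.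

Lemma conn_mono w w' x y : sub_config w w' -> conn w x y -> conn w' x y.
Proof.
move=> ww'; elim/conn_ind => [|y' z _ h [e ee /ww' we]]; first exact: connxx.
by apply: conn_step h _; exists e.
Qed.

Lemma conn_joins w e x y : joins e x y -> w e -> conn w x y.
Proof. by move=> h we; apply: conn_adj; exists e. Qed.

Lemma sub_off w e : sub_config (upd w e false) w.
Proof. by move=> e'; rewrite /upd; case: eqP. Qed.

Lemma sub_on w e : sub_config w (upd w e true).
Proof. by move=> e'; rewrite /upd; case: eqP. Qed.

Lemma sub_upd w w' e b : sub_config w w' -> sub_config (upd w e b) (upd w' e b).
Proof. by move=> h e'; rewrite /upd; case: eqP => // _; exact: h. Qed.

Lemma adj_off w e x y : open_adj w x y -> ~ joins e x y ->
  open_adj (upd w e false) x y.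
Proof.
move=> [e' h we'] nj; exists e' => //; rewrite upd_neq//.
by apply: contra_notN nj => /eqP <-.
Qed.

(** A path is cut at its crossings of the closed edge; only the portions before
    the first crossing and after the last one are kept. *)
Lemma conn_off w e u v x y : joins e u v -> conn w x y ->
  [\/ conn (upd w e false) x y,
      conn (upd w e false) x u /\ conn (upd w e false) v y |
      conn (upd w e false) x v /\ conn (upd w e false) u y].
Proof.
move=> euv; elim/conn_ind => [|y' z _ h a]; first by apply: Or31; exact: connxx.
have [j|nj] := pselect (joins e y' z); last first.
  have b := adj_off a nj.
  case: h => [h|[h h']|[h h']]; [apply: Or31|apply: Or32|apply: Or33];
    by [exact: conn_step b|split=> //; exact: conn_step b].
have [[yE ->]|[yE ->]] := joins_eq euv j; rewrite {}yE in h.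
  case: h => [h|[h _]|[h _]]; [apply: Or32|apply: Or32|exact: Or31];
    by split=> //; exact: connxx.
case: h => [h|[h _]|[h _]]; [apply: Or33|exact: Or31|apply: Or33];
  by split=> //; exact: connxx.
Qed.

Lemma conn_act g w x y :
  conn (act g w) (g * x)%g (g * y)%g <-> conn w x y.
Proof.
suff h k w' x' y' : conn w' x' y' -> conn (act k w') (k * x')%g (k * y')%g.
  split=> [/(h g^-1%g)|]; last exact: h.
  by rewrite actK !mulKg.
elim/conn_ind => [|y1 z _ IH [e ee we]]; first exact: connxx.
by apply: conn_step IH _; exists (eact k e); [exact: joins_eact|rewrite actE].
Qed.

Definition inf_cluster A w x := infinite_set ([set v | conn w x v] `&` A).

Lemma inf_cluster_conn A w x y : conn w x y -> inf_cluster A w x -> inf_cluster A w y.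
Proof.
move=> xy; apply: contra_not => f; apply: sub_finite_set f => z [xz Az].
by split=> //; apply: conn_trans xz; exact: connC.
Qed.

Lemma inf_cluster_mono A A' w w' x : sub_config w w' -> A `<=` A' ->
  inf_cluster A w x -> inf_cluster A' w' x.
Proof.
move=> ww' AA'; apply: contra_not => f; apply: sub_finite_set f => z [xz Az].
by split; [exact: conn_mono xz|exact: AA'].
Qed.

Lemma inf_cluster_act g A w x :
  inf_cluster (lcoset_set g A) (act g w) (g * x)%g <-> inf_cluster A w x.
Proof.
rewrite /inf_cluster (_ : _ `&` _ = lcoset_set g ([set v | conn w x v] `&` A)).
  exact: infinite_lcoset_set.
apply/seteqP; split=> [_ [/[swap] -[v Av <-] h]|_ [v [h Av] <-]].
  by exists v => //; split=> //; exact/(conn_act g).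
by split; [exact/conn_act|exists v].
Qed.

Definition unique_cluster A w :=
  (exists x, inf_cluster A w x) /\ forall x y, inf_cluster A w x -> inf_cluster A w y -> conn w x y.

Lemma unique_infinite_clusterP A w : unique_infinite_cluster A w <-> unique_cluster A w.
Proof.
split=> [[K [[[x _ <-] iK] Kuniq]]|[[x ix] xuniq]].
  split; first by exists x.
  move=> y z iy iz.
  have eqK t : inf_cluster A w t -> [set v | conn w x v] = [set v | conn w t v].
    by move=> it; apply: Kuniq; split=> //; exists t.
  have : [set v | conn w x v] y by rewrite (eqK _ iy); exact: connxx.
  have : [set v | conn w x v] z by rewrite (eqK _ iz); exact: connxx.
  by move=> /= xz /connC yx; exact: conn_trans xz.
exists [set v | conn w x v]; split; first by split=> //; exists x.
move=> _ [[y _ <-] iy]; have xy := xuniq _ _ ix iy.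
by apply/seteqP; split=> v /=; apply: conn_trans => //; exact: connC.
Qed.

Section Measurability.
Hypothesis cG : countable [set: G].

Lemma countable_edge : countable [set: edge S].
Proof.
have /countable_injP[f finj] := cG.
have ends e : exists uv : G * G, joins e uv.1 uv.2.
  by have [u [v h]] := edge_joins e; exists (u, v).
have /choice[h hP] := ends.
apply/countable_injP; exists (fun e => pickle (f (h e).1, f (h e).2)).
move=> e e' _ _ /(pcan_inj pickleK)[/finj h1 /finj h2].
by apply: joins_inj (hP e) _; rewrite h1 ?inE// h2 ?inE//; exact: hP.
Qed.

Lemma countable_seq (T : Type) : countable [set: T] -> countable [set: seq T].
Proof.
move=> /countable_injP[f finj]; apply/countable_injP; exists (pickle \o map f).
have {}finj : injective f by move=> x y; apply: finj; rewrite inE.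
by move=> s s' _ _ /(pcan_inj pickleK)/(inj_map finj).
Qed.

Lemma measurable_open_adj x y :
  measurable [set w : config (edge S) | open_adj w x y].
Proof.
rewrite [X in measurable X](_ : _ = [set w : config (edge S) | exists e, joins e x y /\ w e]).
  apply: event_ex => [|e]; first exact: countable_edge.
  by apply: event_and; [exact: event_prop|exact: event_open].
by apply/seteqP; split=> w [e]; [move=> h we; exists e|move=> [h we]; exists e].
Qed.

Lemma measurable_conn x y : measurable [set w : config (edge S) | conn w x y].
Proof.
rewrite [X in measurable X](_ : _ = [set w : config (edge S) | exists s,
    path (fun x y => `[< open_adj w x y >]) x s /\ y = last x s]).
  apply: event_ex => [|s]; first exact: countable_seq.
  apply: event_and; last exact: event_prop.
  elim: s x => [|z s IH] x /=; first exact: event_prop.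
  rewrite [X in measurable X](_ : _ = [set w : config (edge S) |
     open_adj w x z /\ path (fun x y => `[< open_adj w x y >]) z s]).
    by apply: event_and => //; exact: measurable_open_adj.
  by apply/seteqP; split=> w /= => [/andP[/asboolP]|[/asboolP h h']]; rewrite ?h.
by apply/seteqP; split=> w [s]; [exists s|move=> [? ?]; exists s].
Qed.

(** Infinitude becomes a statement with countable quantifiers, and so defines
    measurable events. *)
Lemma infinite_countableP : exists f : G -> nat, injective f /\
  forall A, infinite_set A <-> forall n, exists x, (n <= f x)%N /\ A x.
Proof.
have /countable_injP[f finj] := cG; exists f.
have {}finj : injective f by move=> x y; apply: finj; rewrite inE.
split=> // A; split=> [iA n|h fA].
  apply: contrapT => nex; apply: iA.
  apply: (@sub_finite_set _ _ (f @^-1` `I_n)); last first.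
    by apply: finite_preimage; [move=> x y _ _; exact: finj|exact: finite_II].
  by move=> x Ax /=; rewrite ltnNge; apply/negP => nx; apply: nex; exists x.
have /finite_seqP[s sA] := fA.
have [x [nx Ax]] := h (\max_(y <- s) f y).+1.
have xs : x \in s by move: Ax; rewrite sA.
by move: nx; rewrite ltnNge leq_bigmax_seq.
Qed.

Lemma measurable_infinite (Phi : config (edge S) -> G -> Prop) :
  (forall x, measurable [set w : config (edge S) | Phi w x]) ->
  measurable [set w : config (edge S) | infinite_set [set x | Phi w x]].
Proof.
move=> mPhi; have [f [_ fP]] := infinite_countableP.
rewrite [X in measurable X](_ : _ = [set w : config (edge S) |
    forall n, exists x, (n <= f x)%N /\ Phi w x]).
  apply: event_all => // n; apply: event_ex => // x.
  by apply: event_and => //; exact: event_prop.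
by apply/seteqP; split=> w /fP.
Qed.

Lemma measurable_inf_cluster A x : measurable [set w : config (edge S) | inf_cluster A w x].
Proof.
apply: (@measurable_infinite (fun w v => conn w x v /\ A v)) => v.
by apply: event_and; [exact: measurable_conn|exact: event_prop].
Qed.

End Measurability.
End Clusters.

Section Generation.
Variables (G : groupType) (S : set G) (genS : generates S).

(** The elements whose right translations preserve [Q] form a subgroup containing
    the generators. *)
Lemma cayley_ind (Q : G -> Prop) x : Q x ->
  (forall u v, cayley_adj S u v -> Q u -> Q v) -> forall y, Q y.
Proof.
move=> Qx step y.
pose H : set G := [set h | forall u, Q u <-> Q (u * h)%g].
have HT : H = [set: G].
  apply: genS => [|s Ss u /=].
    apply: subgroupP => [u|a b Ha Hb u]; first by rewrite mulg1.
    by rewrite /= (Ha u) (Hb (u * (a * b^-1))%g) !mulgA mulgVK.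
  have [<-//|us] := eqVneq u (u * s)%g.
  have a : cayley_adj S u (u * s)%g by split=> //; left; rewrite mulKg.
  split; apply: step => //; split; first by rewrite eq_sym.
  by right; rewrite mulKg.
have : H (x^-1 * y)%g by rewrite HT.
by move=> /(_ x); rewrite mulVKg => <-.
Qed.

End Generation.

(** * Ergodicity and mass transport *)

(** Equality in the union bound forbids overlaps. *)
Lemma overlap_null d (T : measurableType d) (R : realType)
    (P : probability T R) (A : (set T)^nat) (n m : nat) :
  (forall k, measurable (A k)) -> n != m ->
  (\sum_(k <oo) P (A k) <= P (\bigcup_k A k))%E -> P (A n `&` A m) = 0%E.
Proof.
move=> mA nm le; apply/eqP; rewrite eq_le measure_ge0 andbT.
pose A' k := if k == n then A n `\` A m else A k.
have mA' k : measurable (A' k) by rewrite /A'; case: eqP => // _; exact: measurableD.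
have mU : measurable (\bigcup_k A k) by exact: bigcupT_measurable.
have sub : (P (\bigcup_k A k) <= \sum_(k <oo) P (A' k))%E.
  apply: measure_sigma_subadditive => // w [k _ Akw].
  have [Am|nAm] := pselect (A m w); first by exists m => //; rewrite /A' eq_sym (negbTE nm).
  by exists k => //; rewrite /A'; case: eqP => // <-.
move: le; rewrite (@nneseriesD1 _ (fun k => P (A k)) n)//.
rewrite (measureDI P (mA n) (mA m)) => le.
move: sub; rewrite (@nneseriesD1 _ (fun k => P (A' k)) n)//.
rewrite [A' n]/A' eqxx (eq_eseriesr (g := fun k => P (A k))); last first.
  by move=> k /negbTE kn; rewrite /A' kn.
set a := P (A n `\` A m); set b := P (A n `&` A m) in le *.
set s := (\sum_(_ <= _ <oo | _) _)%E in le *; set t := P _ in le *.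
move=> sub; have := le_trans le sub.
have tf : t \is a fin_num by exact: fin_num_measure.
have : (a + s)%E \is a fin_num.
  rewrite ge0_fin_numE; last first.
    by apply: adde_ge0; [exact: measure_ge0|apply: nneseries_ge0].
  apply: le_lt_trans (ltry (fine t)); rewrite fineK//; apply: le_trans le.
  by rewrite -addeA addeCA leeDr.
by move=> asf; rewrite addeAC -[leRHS]adde0 leeD2lE.
Qed.

Section Translations.
Variables (R : realType) (G : groupType) (S : set G).
Hypothesis cG : countable [set: G].
Variables (p : R) (p01 : 0 <= p <= 1) (P : probability (config (edge S)) R).
Hypothesis hP : is_bernoulli p P.
Implicit Types (w : config (edge S)) (g x y : G) (J L : set G).

Lemma event_act g (Phi : config (edge S) -> Prop) :
  measurable [set w | Phi w] -> measurable [set w | Phi (act g w)].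
Proof. exact: measurable_relabelP. Qed.

Lemma act_invariant g (Phi : config (edge S) -> Prop) :
  measurable [set w | Phi w] -> P [set w | Phi (act g w)] = P [set w | Phi w].
Proof.
by move=> mPhi; apply: (relabel_invariant hP _ mPhi); exact: eactKV.
Qed.

Lemma ae_act g (Phi : config (edge S) -> Prop) :
  {ae P, forall w, Phi w} -> {ae P, forall w, Phi (act g w)}.
Proof. by apply: (null_relabel hP); exact: eactKV. Qed.

Lemma ergodic J (Phi : config (edge S) -> Prop) : infinite_set J ->
  measurable [set w | Phi w] ->
  (forall g w, J g -> Phi (act g w) <-> Phi w) ->
  ~ P.-negligible [set w | Phi w] -> {ae P, forall w, Phi w}.
Proof.
move=> iJ mPhi invPhi nPhi.
suff h : forall s : seq (edge S), exists f g : edge S -> edge S,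
  [/\ cancel f g, forall w, Phi (relabel f w) <-> Phi w &
      {in s, forall e, f e \notin s}]
  by case: (zero_one p01 hP mPhi h).
move=> s; have [g Jg gs] := eact_disjoint s iJ.
exists (eact g^-1%g), (eact g); split; first exact: eactKV.
  by move=> w; exact: (invPhi g).
move=> e es; apply/negP => ges; have := gs _ ges.
by rewrite eactKV es.
Qed.

(** Continuity from above: equally likely events occur infinitely often with at
    least their common probability. *)
Lemma infinitely_often J (K : config (edge S) -> G -> Prop) (c : \bar R) :
  infinite_set J -> (forall x, measurable [set w | K w x]) ->
  (forall x, J x -> P [set w | K w x] = c) -> (0 < c)%E ->
  ~ P.-negligible [set w | infinite_set [set x | K w x /\ J x]].
Proof.
move=> iJ mK Kc c0 n0; have [f [finj fP]] := infinite_countableP cG.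
pose F n := [set w | exists x, (n <= f x)%N /\ (K w x /\ J x)].
have mF n : measurable (F n).
  by apply: event_ex => // x; do 2?[apply: event_and] => //; exact: event_prop.
have FE : [set w | infinite_set [set x | K w x /\ J x]] = \bigcap_n F n.
  by apply/seteqP; split=> w /=; rewrite fP => h n; [move=> _|]; exact: h.
have mI : measurable (\bigcap_n F n) by exact: bigcapT_measurable.
have cF n : (c <= P (F n))%E.
  have [x [nx Jx]] := (fP J).1 iJ n.
  by rewrite -(Kc x Jx) le_measure ?inE// => w /= Kw; exists x.
have : P \o F @ \oo --> P (\bigcap_n F n).
  apply: nonincreasing_cvg_mu => //.
    by rewrite ltey_eq fin_num_measure.
  move=> m n mn; apply/subsetPset => w [x [nx h]]; exists x; split=> //.
  exact: leq_trans nx.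
rewrite -FE (measure_negligible _ n0) ?FE// => cv.
have : (c <= 0)%E.
  rewrite -(cvg_lim _ cv)//; apply: lime_ge; first by apply/cvg_ex; exists 0%E.
  by apply: nearW => n; exact: cF.
by rewrite leNgt c0.
Qed.

Section MassTransport.
Variables (L : set G) (sL : subgroup L).
Variable M : config (edge S) -> G -> G -> Prop.
Hypothesis mM : forall x y, measurable [set w | M w x y].
Hypothesis equivM : forall g w x y, L g ->
  M (act g w) (g * x)%g (g * y)%g <-> M w x y.
Hypothesis functM : forall w x y z, M w x y -> M w x z -> y = z.

Variables (f : G -> nat) (finj : injective f).

Let receive n := [set w | exists x, f x = n /\ (L x /\ M w x 1%g)].
Let send := [set w | exists y, L y /\ M w 1%g y].

Let mreceive n : measurable (receive n).
Proof.
apply: event_ex => // x; apply: event_and; first exact: event_prop.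
by apply: event_and; first exact: event_prop.
Qed.

Let msend : measurable send.
Proof. by apply: event_ex => // y; apply: event_and => //; exact: event_prop. Qed.

(** Translating by [x^-1] turns a transfer from [x] to the identity into one from
    the identity to [x^-1]; the latter are disjoint events since mass is sent to
    one point only. *)
Lemma mass_transport : (\sum_(n <oo) P (receive n) = P send)%E.
Proof.
pose B n := [set w | exists x, f x = n /\ (L x /\ M w 1%g x^-1%g)].
have mB n : measurable (B n).
  apply: event_ex => // x; apply: event_and; first exact: event_prop.
  by apply: event_and; first exact: event_prop.
have -> : send = \bigcup_n B n.
  apply/seteqP; split=> w.
    move=> [y [Ly My]]; exists (f y^-1%g) => //; exists y^-1%g.
    by rewrite invgK; split=> //; split=> //; exact: subgroupV.
  by move=> [n _ [x [_ [Lx Mx]]]]; exists x^-1%g; split=> //; exact: subgroupV.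
rewrite measure_bigcup//; last first.
  apply/trivIsetP => i j _ _ ij; apply/seteqP; split=> // w [[x [xi [_ Mx]]] [y [yj [_ My]]]].
  by move/negP: ij; apply; rewrite -xi -yj (invg_inj (functM Mx My)).
rewrite [RHS](eq_eseriesl _ (Q := xpredT)); last by move=> n; rewrite in_setT.
apply: eq_eseriesr => n _.
have [[x xn]|nx] := pselect (exists x, f x = n); last first.
  rewrite (_ : receive n = set0) 1?(_ : B n = set0)//; apply/seteqP;
    by split=> // w [x [xn _]]; case: nx; exists x.
have [Lx|nLx] := pselect (L x); last first.
  rewrite (_ : receive n = set0) 1?(_ : B n = set0)//; apply/seteqP;
    by split=> // w [y [yn [Ly _]]]; apply: nLx; rewrite (finj (etrans xn (esym yn))).
have -> : receive n = [set w | M w x 1%g].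
  apply/seteqP; split=> w /=; last by move=> Mx; exists x.
  by move=> [y [yn [_ My]]]; rewrite (finj (etrans xn (esym yn))).
have -> : B n = [set w | M (act x w) x 1%g].
  apply/seteqP; split=> w /=.
    move=> [y [yn [_ My]]]; rewrite -(finj (etrans xn (esym yn))) in My.
    by apply/(equivM _ _ _ (subgroupV sL Lx)); rewrite actK mulVg mulg1.
  move=> Mx; exists x; split=> //; split=> //.
  by apply/(equivM _ _ _ Lx); rewrite mulgV mulg1.
exact: esym (act_invariant x (mM x 1%g)).
Qed.

(** Borel-Cantelli: the expected number of senders is at most one. *)
Lemma finitely_many_senders :
  {ae P, forall w, finite_set [set x | L x /\ M w x 1%g]}.
Proof.
have : P (lim_sup_set receive) = 0%E.
  apply: lim_sup_set_cvg0 => //; rewrite mass_transport.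
  by rewrite ltey_eq fin_num_measure.
move=> P0; exists (lim_sup_set receive); split=> //.
  by apply: bigcapT_measurable => n; exact: bigcup_measurable.
move=> w /= iw n _; apply: contrapT => nex; apply: iw.
apply: (@sub_finite_set _ _ (f @^-1` `I_n)); last first.
  by apply: finite_preimage; [move=> x y _ _; exact: finj|exact: finite_II].
move=> x [Lx Mx] /=; rewrite ltnNge; apply/negP => nx; apply: nex.
by exists (f x) => //; exists x.
Qed.

(** The number of senders has expectation at most [P Q], by mass transport, and
    is at least one on [Q]: it must be equal to one on [Q], and no point of [Q]
    can omit to send. *)
Lemma balanced_transport (Q : config (edge S) -> Prop) :
  measurable [set w | Q w] ->
  (forall w y, M w 1%g y -> Q w) ->
  {ae P, forall w, Q w -> exists2 x, L x & M w x 1%g} ->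
  {ae P, forall w, (Q w -> exists2 y, L y & M w 1%g y) /\
    forall x y, L x -> L y -> M w x 1%g -> M w y 1%g -> x = y}.
Proof.
move=> mQ MQ QM.
have mU : measurable (\bigcup_n receive n) by exact: bigcupT_measurable.
have sQ : (P send <= P [set w | Q w])%E.
  by rewrite le_measure ?inE// => w [y [_ My]]; exact: MQ My.
have QU : (P [set w | Q w] <= P (\bigcup_n receive n))%E.
  have [N [mN N0 hN]] := QM; have PN : P N = 0%E := N0.
  apply: (@le_trans _ _ (P ((\bigcup_n receive n) `|` N))); last first.
    apply: (@le_trans _ _ (P (\bigcup_n receive n) + P N)%E); first exact: measureU2.
    by rewrite PN adde0.
  rewrite le_measure ?inE//; first exact: measurableU.
  move=> w Qw; have [[x Lx Mx]|nx] := pselect (exists2 x, L x & M w x 1%g).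
    by left; exists (f x) => //; exists x.
  by right; apply: hN => /= /(_ Qw).
have US : (P (\bigcup_n receive n) <= P send)%E.
  by rewrite -mass_transport; exact: measure_sigma_subadditive.
have E1 : P [set w | Q w] = P send.
  by apply/eqP; rewrite eq_le sQ andbT; exact: le_trans QU US.
have aS : {ae P, forall w, Q w -> exists2 y, L y & M w 1%g y}.
  exists ([set w | Q w] `\` send); split; first exact: measurableD.
    transitivity (P [set w | Q w] - P send)%E; last by rewrite E1 subee// fin_num_measure.
    rewrite measureD ?ltey_eq ?fin_num_measure// setIidr//.
    by move=> w [y [_ My]]; exact: MQ My.
  move=> w /= /not_implyP[Qw nex]; split=> // -[y [Ly My]].
  by apply: nex; exists y.
have aU : {ae P, forall w, forall nm : nat * nat,
    nm.1 != nm.2 -> ~ (receive nm.1 `&` receive nm.2) w}.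
  apply: ae_all => // -[n m] /=.
  have [->|nm] := eqVneq n m; first exact: aeW.
  exists (receive n `&` receive m); split; first exact: measurableI.
    apply: overlap_null => //; rewrite mass_transport; exact: le_trans sQ QU.
  by move=> w /= /not_implyP[_ /contrapT].
apply: filterS2 aS aU => w hS hU; split=> // x y Lx Ly Mx My.
apply: contrapT => xy; apply: (hU (f x, f y)) => /=.
  by apply/eqP => /finj.
by split; [exists x|exists y].
Qed.

End MassTransport.

End Translations.

(** * Bridges of the distinguished cluster *)

Section Bridges.
Variables (G : groupType) (S : set G).
Implicit Types (w : config (edge S)) (e : edge S) (g h x y z : G).
Notation conn w := (connected_in w).
Variables (L : set G) (sL : subgroup L).
Variable Kin : config (edge S) -> G -> Prop.
Hypothesis Kact : forall g w x, L g -> Kin (act g w) (g * x)%g <-> Kin w x.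
Hypothesis Kconn : forall w x y, conn w x y -> Kin w x -> Kin w y.
Hypothesis Kmono : forall w w' x, sub_config w w' -> Kin w x -> Kin w' x.

Definition one_cluster w :=
  (exists x, Kin w x) /\ forall x y, Kin w x -> Kin w y -> conn w x y.

(** Uniqueness is only almost sure; this version of it may be applied after
    closing and opening edges. *)
Definition tame w :=
  forall s : seq (edge S * bool), one_cluster (foldr (fun eb w' => upd w' eb.1 eb.2) w s).

Lemma tame_one_cluster w : tame w -> one_cluster w.
Proof. by move=> /(_ [::]). Qed.

Lemma tame_upd w e b : tame w -> tame (upd w e b).
Proof. by move=> h s; have := h (rcons s (e, b)); rewrite foldr_rcons. Qed.

Variables (e0 : edge S) (u0 v0 : G) (e0uv : joins e0 u0 v0).

Definition snip w g := upd w (eact g e0) false.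

(** When the edge is closed, the distinguished cluster stays on the side of [u0]
    and loses on the side of [v0] a part that is infinite in [L]. *)
Definition bridge w g := [/\ w (eact g e0), Kin (snip w g) (g * u0)%g,
  ~ Kin (snip w g) (g * v0)%g & inf_cluster L (snip w g) (g * v0)%g].

Definition branch w g x := conn (snip w g) (g * v0)%g x.

Definition same_cell w x y :=
  forall g, L g -> bridge w g -> (branch w g x <-> branch w g y).

(** Being nearest is read off the family of branches containing [x], which must
    be that of the lower endpoint of [g]: no notion of distance is needed. *)
Definition nearest w x g := [/\ L g, bridge w g & same_cell w x (g * v0)%g].

Definition child w g g' := [/\ L g', bridge w g' & nearest w (g' * u0)%g g].

Let juv g : joins (eact g e0) (g * u0)%g (g * v0)%g.
Proof. exact: joins_eact. Qed.

Lemma bridge_inj w g h : bridge w g -> bridge w h -> eact g e0 = eact h e0 -> g = h.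
Proof.
move=> [_ Ku _ _] [_ _ nKv _] gh.
have jg := juv g; rewrite gh in jg.
have [[/mulIg-> //]|[_ hv]] := joins_eq jg (juv h).
by case: nKv; rewrite hv /snip -gh.
Qed.

Lemma bridge_adj w g : bridge w g -> open_adj w (g * u0)%g (g * v0)%g.
Proof. by case=> we _ _ _; exists (eact g e0) => //; exact: juv. Qed.

Lemma branch_v w g : branch w g (g * v0)%g.
Proof. exact: connxx. Qed.

Lemma branch_u w g : bridge w g -> ~ branch w g (g * u0)%g.
Proof. by move=> [_ Ku nKv _] b; apply: nKv; apply: Kconn Ku; exact: connC. Qed.

Lemma branch_adj w g x y : open_adj w x y -> ~ joins (eact g e0) x y ->
  branch w g x -> branch w g y.
Proof. by move=> a nj b; apply: conn_step b _; exact: adj_off. Qed.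

Lemma same_cell_sym w x y : same_cell w x y -> same_cell w y x.
Proof. by move=> h g Lg gg; rewrite h. Qed.

Lemma same_cell_trans w x y z :
  same_cell w x y -> same_cell w y z -> same_cell w x z.
Proof. by move=> h h' g Lg gg; rewrite h// h'. Qed.

(** A branch is a cluster once its bridge is closed, so an open edge can leave it
    only by being that bridge. *)
Lemma crossing w x y : open_adj w x y ->
  [\/ same_cell w x y,
      exists g, [/\ L g, bridge w g, x = (g * u0)%g & y = (g * v0)%g] |
      exists g, [/\ L g, bridge w g, x = (g * v0)%g & y = (g * u0)%g]].
Proof.
move=> a.
have [[g [Lg gg j]]|nex] := pselect (exists g, [/\ L g, bridge w g & joins (eact g e0) x y]).
  have [[xE yE]|[xE yE]] := joins_eq (juv g) j; [apply: Or32|apply: Or33];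
  by exists g.
apply: Or31 => g Lg gg; have nj : ~ joins (eact g e0) x y by move=> j; apply: nex; exists g.
split; first exact: branch_adj.
by apply: branch_adj; [exact: open_adjC|move=> /joinsC].
Qed.

Lemma nearest_branch w x g : nearest w x g -> branch w g x.
Proof. by move=> [Lg gg s]; apply/s => //; exact: branch_v. Qed.

(** Two distinct bridges with the same cell would lie in each other's branch; but
    what remains of the distinguished cluster after closing both reaches one of
    them without entering the branch of the other. *)
Lemma nearest_unique w x g h : tame w ->
  nearest w x g -> nearest w x h -> g = h.
Proof.
move=> tw [Lg gg sg] [Lh gh sh]; apply: contrapT => nE.
have neE : eact g e0 <> eact h e0 by move=> /(bridge_inj gg gh).
have sgh := same_cell_trans (same_cell_sym sg) sh.
have bhv : branch w h (g * v0)%g by apply/sgh => //; exact: branch_v.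
have bgv : branch w g (h * v0)%g by apply/(sgh g) => //; exact: branch_v.
have bhu : branch w h (g * u0)%g.
  apply: branch_adj bhv; first exact/open_adjC/bridge_adj.
  by move=> /joinsC j; apply: neE; exact: joins_inj (juv g) j.
have bgu : branch w g (h * u0)%g.
  apply: branch_adj bgv; first exact/open_adjC/bridge_adj.
  by move=> /joinsC j; apply: neE; exact: joins_inj j (juv h).
have [_ Kgu nKgv _] := gg; have [_ Khu nKhv _] := gh.
(* A vertex of the distinguished cluster that survives closing both bridges. *)
have [[k Kk] _] := tame_one_cluster (tame_upd (eact h e0) false (tame_upd (eact g e0) false tw)).
have subg : sub_config (upd (snip w g) (eact h e0) false) (snip w g) by exact: sub_off.
have subh : sub_config (upd (snip w g) (eact h e0) false) (snip w h).
  by apply: sub_upd; exact: sub_off.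
have Kgk : Kin (snip w g) k by exact: Kmono Kk.
have Khk : Kin (snip w h) k by exact: Kmono Kk.
have [_ /(_ _ _ Kgk Kgu) c] := tame_one_cluster (tame_upd (eact g e0) false tw).
have noth : conn (snip w g) k (h * u0)%g -> False.
  move=> c'; apply: nKgv; apply: Kconn Kgk; apply: conn_trans c' _.
  exact: connC.
have nothv : conn (snip w g) k (h * v0)%g -> False.
  move=> c'; apply: nKgv; apply: Kconn Kgk; apply: conn_trans c' _.
  exact: connC.
case: (conn_off (juv h) c) => [c'|[c' _]|[c' _]].
- apply: nKhv; apply: Kconn Khk; apply: conn_trans (conn_mono subh c') _.
  exact: connC.
- by apply: noth; exact: conn_mono c'.
- by apply: nothv; exact: conn_mono c'.
Qed.

(** The first edge of a path that leaves the cell of [g] is either the bridge of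
    a child or [g] itself; both are avoided here. *)
Lemma cell_conn w g g1 x : tame w -> L g -> bridge w g ->
  (forall g', child w g g' -> g' = g1) ->
  conn (upd (snip w g) (eact g1 e0) false) (g * v0)%g x -> nearest w x g.
Proof.
move=> tw Lg gg ch; elim/conn_ind=> [|y z _ [_ _ s] [e ej we]]; first by split.
split=> //.
have ene1 : e <> eact g1 e0 by move=> ee; rewrite ee updE in we.
have we' : snip w g e by exact: sub_off we.
have eneg : e <> eact g e0 by move=> ee; rewrite ee /snip updE in we'.
have a : open_adj w y z.
  by exists e => //; exact: sub_off we'.
have [s'|[g' [Lg' gg' yE zE]]|[g' [Lg' gg' yE zE]]] := crossing a.
- exact: same_cell_trans (same_cell_sym s') s.
- case: ene1; rewrite -(ch g'); last by split=> //; rewrite -yE; split.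
  by apply: joins_inj ej _; rewrite yE zE.
- case: eneg; suff -> : g = g' by apply: joins_inj ej _; rewrite yE zE; exact: joinsC.
  by apply: (@nearest_unique w y) => //; split=> //; rewrite yE.
Qed.

(** Otherwise the whole branch, which is infinite in [L], would be the cell. *)
Lemma child_exists w g : tame w -> L g -> bridge w g ->
  finite_set [set x | L x /\ nearest w x g] -> exists g', child w g g'.
Proof.
move=> tw Lg gg fin; apply: contrapT => nex.
have [_ _ _ inf] := gg; apply: inf; apply: sub_finite_set fin => x [c Lx].
split=> //; apply: (@cell_conn w g g) => //; first by move=> g' ch; case: nex; exists g'.
by rewrite /snip upd_upd.
Qed.

Lemma cell_child w g g1 x : tame w -> L g -> bridge w g -> child w g g1 ->
  (forall g', child w g g' -> g' = g1) ->
  branch w g x -> ~ branch w g1 x -> nearest w x g.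
Proof.
move=> tw Lg gg [Lg1 gg1 [_ _ s]] ch b nb; apply: (@cell_conn w g g1) => //.
have subh : sub_config (upd (snip w g) (eact g1 e0) false) (snip w g1).
  by apply: sub_upd; exact: sub_off.
case: (conn_off (juv g1) b) => [//|[_ c]|[c _]].
  by case: nb; exact: conn_mono c.
case: (branch_u gg1); apply/s => //; apply: connC; exact: conn_mono c.
Qed.

(** The bridges form bi-infinite chains, with cells that are finite in [L]. *)
Definition regular w := [/\ tame w,
  forall g, L g -> bridge w g -> finite_set [set x | L x /\ nearest w x g],
  forall g, L g -> bridge w g ->
    exists2 g1, child w g g1 & forall g', child w g g' -> g' = g1,
  forall g, L g -> bridge w g -> exists g', nearest w (g * u0)%g g' &
  exists g, L g /\ bridge w g].

(** This propagates along paths: going down through a bridge leads to its own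
    cell, going up through it leads to the cell of its parent. *)
Lemma regular_nearest w x : regular w -> Kin w x -> exists g, nearest w x g.
Proof.
move=> [tw _ _ par [g0 [Lg0 gg0]]] Kx.
have Ku : Kin w (g0 * u0)%g.
  by case: gg0 => _ Ku _ _; apply: Kmono Ku; exact: sub_off.
have [_ /(_ _ _ Ku Kx)] := tame_one_cluster tw.
elim/conn_ind => [|y z _ [g ng] a]; first exact: par.
have [s|[g' [Lg' gg' yE zE]]|[g' [Lg' gg' yE zE]]] := crossing a.
- have [Lg gg s'] := ng; exists g; split=> //.
  exact: same_cell_trans (same_cell_sym s) s'.
- by exists g'; rewrite zE; split.
- by rewrite zE; exact: par.
Qed.

(** Iterate the passage to the child.  A path crosses finitely many bridges, so a
    given vertex is left behind after finitely many steps, and each step loses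
    one cell, which is finite in [L]. *)
Lemma descent w g z1 z2 : regular w -> L g -> bridge w g ->
  conn w (g * v0)%g z1 -> conn w (g * v0)%g z2 -> exists d,
  [/\ ~ branch w d z1, ~ branch w d z2 &
      finite_set [set x | L x /\ (branch w g x /\ ~ branch w d x)]].
Proof.
move=> [tw fin ch _ _] Lg gg c1 c2.
have : forall h, exists h', L h -> bridge w h ->
    child w h h' /\ forall h'', child w h h'' -> h'' = h'.
  move=> h; have [[Lh gh]|n] := pselect (L h /\ bridge w h).
    by have [h' c u] := ch h Lh gh; exists h'.
  by exists h => Lh gh; case: n.
move=> /choice[nxt nxtP]; pose d n := iter n nxt g.
have dP n : L (d n) /\ bridge w (d n).
  elim: n => // n [Ln gn].
  by have [[Lc gc _] _] := nxtP _ Ln gn.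
have dch n : child w (d n) (d n.+1) by apply: (nxtP _ _ _).1; case: (dP n).
have dun n h : child w (d n) h -> h = d n.+1.
  by apply: (nxtP _ _ _).2; case: (dP n).
have down n h : L h -> bridge w h ->
    branch w h (d n * v0)%g -> h <> d n.+1 /\ branch w h (d n.+1 * v0)%g.
  move=> Lh gh b; have [Ld gd [_ _ s]] := dch n.
  have bu : branch w h (d n.+1 * u0)%g by apply/s.
  have hd : h <> d n.+1 by move=> hd; apply: (branch_u gd); rewrite -hd {2}hd.
  split=> //; apply: branch_adj bu; first exact: bridge_adj.
  by move=> j; apply: hd; apply: bridge_inj gh gd _; exact: joins_inj j (juv _).
have downs n m h : L h -> bridge w h -> (n <= m)%N ->
    branch w h (d n * v0)%g -> branch w h (d m * v0)%g.
  move=> Lh gh; elim: m => [|m IH]; first by rewrite leqn0 => /eqP->.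
  by rewrite leq_eqVlt => /orP[/eqP->//|nm] /(IH nm)/(down m h Lh gh)[].
have nbr n m : (n < m)%N -> ~ branch w (d m) (d n * v0)%g.
  case: m => // m nm /(@downs _ m _ (dP _).1 (dP _).2 nm).
  by move=> /(down _ _ (dP _).1 (dP _).2)[].
have dinj n m : d n = d m -> n = m.
  move=> E; have [nm|nm|//] := ltngtP n m; [case: (nbr _ _ nm)|case: (nbr _ _ nm)];
  by rewrite ?E// -?E; exact: branch_v.
have far z : conn w (g * v0)%g z ->
    exists N, forall n, (N <= n)%N -> ~ branch w (d n) z.
  elim/conn_ind => [|y z' _ [N hN] a]; first by exists 1%N => n; exact: (nbr 0%N).
  have [[n0 j]|nj] := pselect (exists n, joins (eact (d n) e0) y z').
    exists (maxn N n0.+1) => n; rewrite geq_max => /andP[Nn n0n] b; apply: (hN n Nn).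
    apply: branch_adj b; first exact: open_adjC.
    move=> /joinsC j'; have := bridge_inj (dP n).2 (dP n0).2 (joins_inj j' j).
    by move=> /dinj E; rewrite E ltnn in n0n.
  exists N => n Nn b; apply: (hN n Nn); apply: branch_adj b; first exact: open_adjC.
  by move=> /joinsC j; apply: nj; exists n.
have [N1 hN1] := far _ c1; have [N2 hN2] := far _ c2.
exists (d (maxn N1 N2)); split; [exact/hN1/leq_maxl|exact/hN2/leq_maxr|].
elim: (maxn N1 N2) => [|n IH].
  by rewrite (_ : [set x | _] = set0)//; apply/seteqP; split=> // x [_ []].
have [Ln gn] := dP n.
have fU : finite_set ([set x | L x /\ (branch w g x /\ ~ branch w (d n) x)] `|`
    [set x | L x /\ nearest w x (d n)]).
  by rewrite finite_setU; split=> //; exact: fin.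
apply: sub_finite_set fU => x [Lx [b nb]].
have [bn|nbn] := pselect (branch w (d n) x); last by left.
by right; split=> //; apply: (cell_child tw Ln gn (dch n)) => // h; exact: dun.
Qed.

Lemma infinite_pick (T : Type) (A D : set T) : infinite_set A -> finite_set D ->
  exists2 x, A x & ~ D x.
Proof.
move=> iA fD; apply: contrapT => nex; apply: iA; apply: sub_finite_set fD => x Ax.
by apply: contrapT => nD; apply: nex; exists x.
Qed.

(** Suppose that [e0] links the distinguished cluster to another cluster [X] that
    is infinite in [L], and let [g] be the bridge nearest to [u0].  Once [e0] is
    open, the branch of [g] consists of its former self and [X], both infinite
    in [L], joined by [e0] only.  A deep descendant branch avoids [e0] but misses
    only finitely many points of [L], hence meets both parts and connects them
    without [e0]. *)
Lemma no_attachment w : regular (upd w e0 false) -> regular (upd w e0 true) ->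
  Kin (upd w e0 false) u0 -> inf_cluster L (upd w e0 false) v0 ->
  Kin (upd w e0 false) v0.
Proof.
set w0 := upd w e0 false; set w1 := upd w e0 true => r0 r1 Ku0 inf0.
apply: contrapT => nKv0.
have w01 : sub_config w0 w1 by move=> e; rewrite /w0 /w1 /upd; case: eqP.
have w1e0 : w1 e0 by rewrite /w1 updE.
have [g ng] := regular_nearest r0 Ku0.
have bu0 := nearest_branch ng; have [Lg gg _] := ng.
have [we Ku nKv inf] := gg.
have neq : eact g e0 != e0 by apply/eqP => E; rewrite E /w0 updE in we.
have off1 : upd (snip w1 g) e0 false = snip w0 g.
  by rewrite /snip /w1 updC// upd_upd.
have cut01 : sub_config (snip w0 g) (snip w1 g) by exact: sub_upd.
have subw0 : sub_config (snip w0 g) w0 by exact: sub_off.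
have Kgu : Kin w0 (g * u0)%g by exact: Kmono Ku.
have adj0 : conn w0 (g * v0)%g (g * u0)%g.
  by apply: conn_adj; apply: open_adjC; exact: bridge_adj.
have Kgv : Kin w0 (g * v0)%g by apply: Kconn Kgu; exact: connC.
have nv0 x : conn w0 v0 x -> ~ Kin w0 x.
  by move=> c Kx; apply: nKv0; apply: Kconn Kx; exact: connC.
have tw1 : tame w1 by case: r1.
have g1g : bridge w1 g.
  split; first exact: w01.
  - exact: Kmono Ku.
  - move=> Kv1; have Ku1 := Kmono cut01 Ku.
    have [_ /(_ _ _ Kv1 Ku1) c] := tame_one_cluster (tame_upd (eact g e0) false tw1).
    case: (conn_off e0uv c); rewrite -/(snip w1 g) off1.
    + exact: branch_u gg.
    + by move=> [_ /(conn_mono subw0)/nv0].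
    + by move=> [/(conn_mono subw0)/connC/nv0 h _]; exact: h.
  - exact: (inf_cluster_mono cut01 (@subset_refl _ L)).
have cu0 : conn w1 (g * v0)%g u0 by apply: conn_mono bu0 => e /subw0/w01.
have cv0 : conn w1 (g * v0)%g v0.
  by apply: conn_trans cu0 _; exact: conn_joins e0uv w1e0.
have [d [ndu ndv fin]] := descent r1 Lg g1g cu0 cv0.
have bv0 : branch w1 g v0.
  apply: (@branch_adj w1 g u0 v0); first by exists e0.
    by move=> j; move/eqP: neq; apply; exact: joins_inj j e0uv.
  exact: conn_mono cut01 bu0.
have X1 x : conn w0 v0 x -> branch w1 g x.
  move=> c; apply: conn_trans bv0 _.
  case: (conn_off (juv g) c) => [c'|[c' _]|[c' _]].
  - exact: conn_mono cut01 c'.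
  - by case: (nv0 _ (conn_mono subw0 c')).
  - by case: (nv0 _ (conn_mono subw0 c')).
have [x1 [c1 Lx1] nD1] := infinite_pick inf0 fin.
have [x2 [c2 Lx2] nD2] := infinite_pick inf fin.
have b1 : branch w1 d x1.
  by apply: contrapT => nb; apply: nD1; split=> //; split=> //; exact: X1.
have b2 : branch w1 d x2.
  apply: contrapT => nb; apply: nD2; split=> //; split=> //.
  exact: conn_mono cut01 c2.
have c12 : conn (snip w1 d) x1 x2 by apply: conn_trans b2; exact: connC.
case: (conn_off e0uv c12) => [c|[c _]|[c _]].
- have c' : conn w0 x1 x2.
    apply: conn_mono c => e; rewrite /snip /w1 /w0 /upd.
    by case: eqP => // _; case: eqP.
  apply: (nv0 _ (conn_trans c1 c')); apply: Kconn Kgv.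
  exact: conn_mono c2.
- apply: ndu; apply: conn_trans b1 _; apply: conn_mono c; exact: sub_off.
- apply: ndv; apply: conn_trans b1 _; apply: conn_mono c; exact: sub_off.
Qed.

Lemma snip_act g h w : snip (act g w) (g * h)%g = act g (snip w h).
Proof. by rewrite /snip act_upd eactM. Qed.

Lemma inf_cluster_act_subgroup g w x : L g ->
  inf_cluster L (act g w) (g * x)%g <-> inf_cluster L w x.
Proof. by move=> Lg; rewrite -{1}(lcoset_set_id sL Lg); exact: inf_cluster_act. Qed.

Lemma bridge_act g h w : L g -> bridge (act g w) (g * h)%g <-> bridge w h.
Proof.
move=> Lg; rewrite /bridge snip_act eactM actE -!mulgA.
split=> [[? /(Kact _ _ Lg)? nK /(inf_cluster_act_subgroup _ _ Lg)?]|[? ? nK ?]]; split=> //.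
- by move=> /(Kact _ _ Lg).
- exact/(Kact _ _ Lg).
- by move=> /(Kact _ _ Lg).
- exact/(inf_cluster_act_subgroup _ _ Lg).
Qed.

Lemma branch_act g h w x :
  branch (act g w) (g * h)%g (g * x)%g <-> branch w h x.
Proof. by rewrite /branch snip_act -mulgA; exact: conn_act. Qed.

Lemma same_cell_act g w x y : L g ->
  same_cell (act g w) (g * x)%g (g * y)%g <-> same_cell w x y.
Proof.
move=> Lg; split=> s h Lh.
  move=> gh; have := s (g * h)%g (subgroupM sL Lg Lh).
  by rewrite !branch_act; apply; exact/bridge_act.
rewrite -[h](mulVKg g) bridge_act// !branch_act; apply: s.
exact: subgroupM (subgroupV sL Lg) Lh.
Qed.

Lemma nearest_act g h w x : L g ->
  nearest (act g w) (g * x)%g (g * h)%g <-> nearest w x h.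
Proof.
move=> Lg; rewrite /nearest -!mulgA; split=> -[Lh gh sh]; split.
- by rewrite -[h](mulKg g); exact: subgroupM (subgroupV sL Lg) Lh.
- exact/(bridge_act _ _ Lg).
- exact/(same_cell_act _ _ _ Lg).
- exact: subgroupM.
- exact/bridge_act.
- exact/same_cell_act.
Qed.

End Bridges.

(** * The distinguished cluster absorbs all infinite clusters *)

Section Domination.
Variables (R : realType) (G : groupType) (S : set G).
Hypotheses (cG : countable [set: G]) (genS : generates S).
Variables (p : R) (p0 : 0 < p) (p1 : p < 1) (P : probability (config (edge S)) R).
Hypothesis hP : is_bernoulli p P.
Implicit Types (w : config (edge S)) (e : edge S) (g h x y z : G).
Notation conn w := (connected_in w).
Variables (L : set G) (sL : subgroup L) (iL : infinite_set L).
Variable Kin : config (edge S) -> G -> Prop.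
Hypothesis mK : forall x, measurable [set w | Kin w x].
Hypothesis Kact : forall g w x, L g -> Kin (act g w) (g * x)%g <-> Kin w x.
Hypothesis Kconn : forall w x y, conn w x y -> Kin w x -> Kin w y.
Hypothesis Kmono : forall w w' x, sub_config w w' -> Kin w x -> Kin w' x.
Hypothesis Kae : {ae P, forall w, one_cluster Kin w}.

Let p01 : 0 <= p <= 1. Proof. by rewrite !ltW. Qed.

Lemma tame_ae : {ae P, forall w, tame Kin w}.
Proof.
apply: ae_all => [|s].
  have cE : countable [set: edge S] by exact: countable_edge.
  apply: countable_seq; rewrite -setXTT; apply: countableX => //.
elim/last_ind: s => [//|s [e b] IH].
have pb : if b then 0 < p else p < 1 by case: b.
apply: ae_imp (ae_upd p01 hP e pb IH) => w.
by rewrite foldr_rcons.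
Qed.

Section OneBridge.
Variables (e0 : edge S) (u0 v0 : G) (e0uv : joins e0 u0 v0).
Notation bridge := (bridge L Kin e0 u0 v0).
Notation nearest := (nearest L Kin e0 u0 v0).
Notation child := (child L Kin e0 u0 v0).
Notation regular := (regular L Kin e0 u0 v0).

Lemma event_bridge g : measurable [set w | bridge w g].
Proof.
rewrite [X in measurable X](_ : _ = [set w : config (edge S) | w (eact g e0) /\
  (Kin (snip e0 w g) (g * u0)%g /\
  (~ Kin (snip e0 w g) (g * v0)%g /\ inf_cluster L (snip e0 w g) (g * v0)%g))]).
  do 3?[apply: event_and]; first exact: event_open.
  - exact: (measurable_updP _ _ (mK _)).
  - by apply: event_not; exact: (measurable_updP _ _ (mK _)).
  - exact: (measurable_updP _ _ (measurable_inf_cluster cG L _)).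
by apply/seteqP; split=> w; [case=> ? ? ? ?|case=> ? [? [? ?]]; split].
Qed.

Lemma event_branch g x : measurable [set w | branch e0 v0 w g x].
Proof. exact: (measurable_updP _ _ (measurable_conn cG _ _)). Qed.

Lemma event_nearest x g : measurable [set w | nearest w x g].
Proof.
rewrite [X in measurable X](_ : _ = [set w : config (edge S) | L g /\ (bridge w g /\
  forall h, L h -> bridge w h ->
    (branch e0 v0 w h x <-> branch e0 v0 w h (g * v0)%g))]).
  apply: event_and; first exact: event_prop.
  apply: event_and; first exact: event_bridge.
  apply: event_all => // h; apply: event_imp; first exact: event_prop.
  by apply: event_imp; [exact: event_bridge|apply: event_iff; exact: event_branch].
by apply/seteqP; split=> w; [case=> ? ? ?|case=> ? [? ?]; split].
Qed.

(** Uniqueness, which holds in tame configurations, is added so that the transport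
    is functional in every configuration. *)
Let sole w x g := nearest w x g /\ forall h, nearest w x h -> h = g.

Let msole x g : measurable [set w | sole w x g].
Proof.
apply: event_and; first exact: event_nearest.
apply: event_all => // h; apply: event_imp; first exact: event_nearest.
exact: event_prop.
Qed.

Let sole_act g w x h : L g ->
  sole (act g w) (g * x)%g (g * h)%g <-> sole w x h.
Proof.
have na := nearest_act sL Kact e0 u0 v0.
move=> Lg; split=> -[n u]; split.
- exact/(na g).
- by move=> k /(na g _ _ _ Lg)/u/mulgI.
- exact/na.
- by move=> k; rewrite -{1}[k](mulVKg g) => /(na g _ _ _ Lg)/u <-; rewrite mulVKg.
Qed.

Let soleP w x g : tame Kin w -> nearest w x g -> sole w x g.
Proof.
by move=> tw n; split=> // h nh; exact: (nearest_unique Kconn Kmono e0uv tw nh n).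
Qed.

Let sole_funct w x y z : sole w x y -> sole w x z -> y = z.
Proof. by move=> [_ u] [nz _]; rewrite (u z). Qed.

Let finite_cells :
  {ae P, forall w, finite_set [set x | L x /\ nearest w x 1%g]}.
Proof.
have [f [finj _]] := infinite_countableP cG.
have a := finitely_many_senders cG hP sL msole sole_act sole_funct finj.
apply: ae_imp (ae_and tame_ae a) => w [tw]; apply: sub_finite_set => x [Lx n].
by split=> //; exact: soleP.
Qed.

Let parent w g h := bridge w g /\ sole w (g * u0)%g h.

Let mparent g h : measurable [set w | parent w g h].
Proof. by apply: event_and; [exact: event_bridge|exact: msole]. Qed.

Let parent_act g w h k : L g ->
  parent (act g w) (g * h)%g (g * k)%g <-> parent w h k.
Proof.
have ga := bridge_act sL Kact e0 u0 v0.
move=> Lg; rewrite /parent -mulgA; split=> -[gh s]; split.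
- exact/(ga g).
- exact/(sole_act w _ _ Lg).
- exact/ga.
- exact/sole_act.
Qed.

Let parent_funct w g h k : parent w g h -> parent w g k -> h = k.
Proof. by move=> [_ sh] [_ sk]; exact: sole_funct sh sk. Qed.

Let balanced : {ae P, forall w, (bridge w 1%g -> exists2 y, L y & parent w 1%g y) /\
    forall x y, L x -> L y -> parent w x 1%g -> parent w y 1%g -> x = y}.
Proof.
have [f [finj _]] := infinite_countableP cG.
apply: (balanced_transport cG hP sL mparent parent_act parent_funct finj).
- exact: event_bridge.
- by move=> w y [].
- apply: ae_imp (ae_and tame_ae finite_cells) => w [tw fin] g1.
  have [x [Lx gx nx]] := child_exists Kconn Kmono e0uv tw (subgroup1 sL) g1 fin.
  by exists x => //; split=> //; exact: soleP.
Qed.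

(** Finite cells come from the transport of points to their nearest bridge; then
    each bridge has a child, so the transport of bridges to their parent is
    balanced. *)
Lemma regular_ae : ~ P.-negligible [set w | bridge w 1%g] ->
  {ae P, forall w, regular w}.
Proof.
move=> nn.
pose local w := [/\ finite_set [set x | L x /\ nearest w x 1%g],
  bridge w 1%g -> exists2 g1, child w 1%g g1 & forall g', child w 1%g g' -> g' = g1 &
  bridge w 1%g -> exists g', nearest w (1 * u0)%g g'].
have local_ae : {ae P, forall w, local w}.
  have a := ae_and tame_ae (ae_and finite_cells balanced).
  apply: ae_imp a => w [tw [fin [par uni]]]; split=> // g1.
    have [x cx] := child_exists Kconn Kmono e0uv tw (subgroup1 sL) g1 fin.
    exists x => // y [Ly gy ny]; have [Lx gx nx] := cx.
    by apply: uni => //; split=> //; exact: soleP.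
  by have [y _ [_ [ny _]]] := par g1; exists y.
have locals_ae : {ae P, forall w g, local (act g^-1%g w)}.
  by apply: ae_all => // g; exact: (ae_act hP _ local_ae).
have bridge_ae : {ae P, forall w, exists g, L g /\ bridge w g}.
  apply: (ergodic p01 hP iL).
  - by apply: event_ex => // g; apply: event_and; [exact: event_prop|exact: event_bridge].
  - have ga := bridge_act sL Kact e0 u0 v0.
    move=> h w Lh; split=> -[g [Lg gg]].
      exists (h^-1 * g)%g; split; first exact: subgroupM (subgroupV sL Lh) Lg.
      by apply/(ga h) => //; rewrite mulVKg.
    by exists (h * g)%g; split; [exact: subgroupM|exact/ga].
  - by apply: nonnullS nn => w g1; exists 1%g; split=> //; exact: subgroup1.
apply: ae_imp (ae_and tame_ae (ae_and locals_ae bridge_ae)) => w [tw [loc ex]].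
have na := nearest_act sL Kact e0 u0 v0.
have ga := bridge_act sL Kact e0 u0 v0.
have shift g : L g -> exists w', w = act g w' /\ local w'.
  by move=> _; exists (act g^-1%g w); split; [rewrite actKV|exact: loc].
split=> // g Lg; have [w' [-> [fin ch par]]] := shift g Lg.
- move=> _; have := finite_image (fun x => g * x)%g fin.
  apply: sub_finite_set => x [Lx n]; exists (g^-1 * x)%g; last by rewrite mulVKg.
  split; first exact: subgroupM (subgroupV sL Lg) Lx.
  by apply/(na g) => //; rewrite mulVKg mulg1.
- move=> gg; have g1' : bridge w' 1%g by apply/(ga g) => //; rewrite mulg1.
  have [g1 [Lg1 gg1 n1] uni] := ch g1'.
  exists (g * g1)%g.
    split; [exact: subgroupM|exact/ga|].
    by rewrite -[X in nearest _ _ X]mulg1 -mulgA; apply/na.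
  move=> g' [Lg' gg' n']; rewrite -[g'](mulVKg g); congr (_ * _)%g; apply: uni.
  rewrite -[g'](mulVKg g) in gg' n'; split.
  + exact: subgroupM (subgroupV sL Lg) Lg'.
  + exact/(ga g).
  + by apply/(na g) => //; rewrite mulgA mulg1.
- move=> gg; have g1' : bridge w' 1%g by apply/(ga g) => //; rewrite mulg1.
  have [g' n'] := par g1'.
  by exists (g * g')%g; apply/na => //; move: n'; rewrite mul1g.
Qed.

(** Opening [e0] would create a bridge, so that almost every configuration would
    be regular, and remain so after closing or opening [e0]. *)
Lemma link_null : P.-negligible [set w |
  [/\ Kin (upd w e0 false) u0, ~ Kin (upd w e0 false) v0 &
      inf_cluster L (upd w e0 false) v0]].
Proof.
apply: contrapT => nB.
have nn : ~ P.-negligible [set w | bridge w 1%g].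
  move=> ng; apply: nB.
  apply: negligibleS (null_upd p01 hP (b := true) e0 p0 ng) => w /= [? ? ?].
  by rewrite /bridge /snip eact1 !mul1g updE upd_upd.
have r := regular_ae nn.
have r0 := ae_upd p01 hP (b := false) e0 p1 r.
have r1 := ae_upd p01 hP (b := true) e0 p0 r.
have [w [[Ku nKv inf] [r0w r1w]]] := nonnull_point (nonnull_ae nB (ae_and r0 r1)).
apply: nKv; exact: (no_attachment Kconn Kmono e0uv r0w r1w).
Qed.

End OneBridge.

(** Walk from the distinguished cluster to the other cluster, at [x].  If the
    last vertex [u] before [x] is in the distinguished cluster, the last edge is
    a link of the kind just excluded; otherwise open this edge and use [u]
    in place of [x], one step closer to the distinguished cluster. *)
Lemma distinguished_dominates : {ae P, forall w x, inf_cluster L w x -> Kin w x}.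
Proof.
apply: contrapT => na.
pose N x k w := [/\ inf_cluster L w x, ~ Kin w x & Kin w k].
have nn : ~ P.-negligible [set w | exists x, inf_cluster L w x /\ ~ Kin w x].
  apply: contra_not na; apply: negligibleS => w /= /existsNP[x /not_implyP h].
  by exists x.
have [x nx] := nonnull_ex cG nn.
have nk : ~ P.-negligible [set w | exists k, N x k w].
  by apply: nonnullS (nonnull_ae nx Kae) => w [[ix nKx] [[k Kk] _]]; exists k.
have [k nxk] := nonnull_ex cG nk.
(* Move [x] along a path of the Cayley graph starting at [k]. *)
move: x nxk {nx nk}; apply: (cayley_ind genS (x := k)).
  apply; rewrite (_ : [set w | _] = set0); first exact: negligible_set0.
  by apply/seteqP; split=> // w [].
move=> u v /adj_edge[e euv] IH nvk; apply: IH.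
have split_u : ~ P.-negligible [set w | N v k w /\ ~ Kin w u].
  move=> n; apply: nvk; apply: negligibleS (negligibleU n (link_null euv)) => w /= Nw.
  have [Ku|] := pselect (Kin w u); [right|by left].
  have [iv nKv Kk] := Nw; have we : w e = false.
    apply/negbTE/negP => we; apply: nKv; apply: Kconn Ku; exact: conn_joins euv we.
  by rewrite -we upd_id.
have := nonnull_ae split_u tame_ae; apply: contra_not.
move=> n; apply: negligibleS (null_upd p01 hP (b := true) e p0 n) => w /=.
move=> [[[iv nKv Kk] nKu] tw].
have sub := @sub_on _ _ w e.
have uv : conn (upd w e true) v u by apply/connC/(conn_joins euv); rewrite updE.
split; first exact: inf_cluster_conn uv (inf_cluster_mono sub (@subset_refl _ L) iv).
- move=> Ku; have [_ /(_ _ _ Ku (Kmono sub Kk)) c] := tame_one_cluster (tame_upd e true tw).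
  have off : sub_config (upd (upd w e true) e false) w by rewrite upd_upd; exact: sub_off.
  case: (conn_off euv c) => [c'|[_ c']|[_ c']].
  + by apply: nKu; apply: Kconn Kk; apply: connC; exact: conn_mono c'.
  + by apply: nKv; apply: Kconn Kk; apply: connC; exact: conn_mono c'.
  + by apply: nKu; apply: Kconn Kk; apply: connC; exact: conn_mono c'.
- exact: Kmono Kk.
Qed.

End Domination.

(** * Transfer of uniqueness between subgroups *)

Lemma nonnull_gt0 d (T : measurableType d) (R : realType) (P : probability T R)
    (A : set T) : measurable A -> ~ P.-negligible A -> (0 < P A)%E.
Proof.
move=> mA n; rewrite lt_neqAle measure_ge0 andbT eq_sym.
by apply/eqP => P0; apply: n; exists A; split.
Qed.

Section Uniqueness.
Variables (R : realType) (G : groupType) (S : set G).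
Hypotheses (cG : countable [set: G]) (genS : generates S).
Variables (p : R) (p01 : 0 <= p <= 1) (P : probability (config (edge S)) R).
Hypothesis hP : is_bernoulli p P.
Implicit Types (w : config (edge S)) (e : edge S) (g h x y z : G).
Notation conn w := (connected_in w).

Lemma ae_nonnull (Phi : config (edge S) -> Prop) :
  {ae P, forall w, Phi w} -> ~ P.-negligible [set w | Phi w].
Proof.
move=> a n.
have [N [_ N0 TN]] : P.-negligible [set: config (edge S)].
  apply: negligibleS (negligibleU a n) => w _.
  by have [|] := pselect (Phi w); [right|left].
have : P [set: config (edge S)] = 0%E by rewrite -(_ : N = setT)//; apply/seteqP; split.
by move/eqP; rewrite probability_setT eqe oner_eq0.
Qed.

Lemma ae_point (Phi : config (edge S) -> Prop) :
  {ae P, forall w, Phi w} -> exists w, Phi w.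
Proof. by move=> /ae_nonnull/nonnull_point. Qed.

Lemma no_cluster_at_0 A : p = 0 -> ~ {ae P, forall w, unique_cluster A w}.
Proof.
move=> p0 uA; have cE : countable [set: edge S] by exact: countable_edge.
have closed_ae : {ae P, forall w e, ~ w e}.
  apply: ae_all => // e.
  exists [set w : config (edge S) | w e]; split; first exact: event_open.
    transitivity (P [set w : config (edge S) | forall e', e' \in [:: e] -> w e' = true]).
      congr (P _); apply/seteqP; split=> w /=; first by move=> we e'; rewrite inE => /eqP->.
      by move=> h; apply: h; rewrite inE.
    by rewrite (hP (fun=> true))// big_seq1 p0.
  by move=> w /= /contrapT.
have [w [[[x ix] _] cl]] := ae_point (ae_and uA closed_ae).
apply: ix; apply: (@sub_finite_set _ _ [set x]) => // y [c _]; move: y c.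
by apply: conn_ind => // y z _ _ [e _ /cl].
Qed.

Lemma unique_cluster_at_1 A : infinite_set A -> p = 1 ->
  {ae P, forall w, unique_cluster A w}.
Proof.
move=> iA p1; have cE : countable [set: edge S] by exact: countable_edge.
have open_ae : {ae P, forall w e, w e}.
  apply: ae_all => // e.
  exists [set w : config (edge S) | ~ w e]; split=> //.
    by apply: event_not; exact: event_open.
  transitivity (P [set w : config (edge S) | forall e', e' \in [:: e] -> w e' = false]).
    congr (P _); apply/seteqP; split=> w /=.
      by move=> /negP/negbTE we e'; rewrite inE => /eqP->.
    by move=> h; rewrite h// inE.
  by rewrite (hP (fun=> false))// big_seq1 p1 subrr.
apply: ae_imp open_ae => w op.
have c x y : conn w x y.
  apply: (cayley_ind genS (x := x)) y => [|u v /adj_edge[e euv] xu].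
    exact: connxx.
  by apply: conn_trans xu _; exact: conn_joins euv (op e).
split=> //; exists 1%g; apply: contra_not iA; apply: sub_finite_set => x Ax.
by split=> //; exact: c.
Qed.

(** Opening the edges of a path extends the cluster to any given vertex. *)
Lemma everywhere_nonnull (K : config (edge S) -> G -> Prop) x : 0 < p ->
  (forall w x y, conn w x y -> K w x -> K w y) ->
  (forall w w' x, sub_config w w' -> K w x -> K w' x) ->
  {ae P, forall w, exists y, K w y} -> ~ P.-negligible [set w | K w x].
Proof.
move=> p0 Kconn Kmono Kae.
have [y ny] : exists y, ~ P.-negligible [set w | K w y].
  by apply: nonnull_ex => //; exact: ae_nonnull.
move: x; apply: (cayley_ind genS (x := y)) => // u v /adj_edge[e euv].
apply: contra_not => n.
apply: negligibleS (null_upd p01 hP (b := true) e p0 n) => w /= Ku.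
apply: (Kconn (upd w e true) u v _ (Kmono _ _ _ (@sub_on _ _ w e) Ku)).
by apply: conn_joins euv _; rewrite updE.
Qed.

(** All points of [H1] are equally likely to be in the [H2]-infinite cluster, so
    infinitely many of them are, at first with positive probability and then
    almost surely by ergodicity. *)
Lemma unique_sub (H1 H2 : set G) : 0 < p -> subgroup H1 -> subgroup H2 ->
  H1 `<=` H2 -> infinite_set H1 ->
  {ae P, forall w, unique_cluster H2 w} -> {ae P, forall w, unique_cluster H1 w}.
Proof.
move=> p0 s1 s2 s12 i1 u2.
have Kact h w x : H2 h -> inf_cluster H2 (act h w) (h * x)%g <-> inf_cluster H2 w x.
  exact: inf_cluster_act_subgroup.
have mK x : measurable [set w : config (edge S) | inf_cluster H2 w x].
  exact: measurable_inf_cluster.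
have nK : ~ P.-negligible [set w | inf_cluster H2 w 1%g].
  apply: everywhere_nonnull p0 _ _ _.
  - exact: inf_cluster_conn.
  - by move=> w w' x /inf_cluster_mono; exact.
  - by apply: ae_imp u2 => w [].
have Kc h : H1 h -> P [set w | inf_cluster H2 w h] = P [set w | inf_cluster H2 w 1%g].
  move=> /s12 h2; rewrite -(act_invariant hP h (mK h)); congr (P _).
  by apply/seteqP; split=> w /=; rewrite -{2}[h]mulg1 Kact.
have io := infinitely_often cG i1 mK Kc (nonnull_gt0 (mK _) nK).
have io_ae : {ae P, forall w : config (edge S), infinite_set [set x | inf_cluster H2 w x /\ H1 x]}.
  apply: (ergodic p01 hP i1) io.
    apply: measurable_infinite => // x.
    by apply: event_and => //; exact: event_prop.
  move=> h w h1.
  suff -> : [set x | inf_cluster H2 (act h w) x /\ H1 x] =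
      lcoset_set h [set x | inf_cluster H2 w x /\ H1 x].
    exact: infinite_lcoset_set.
  apply/seteqP; split=> [x [ix x1]|_ [x [ix x1] <-]].
    exists (h^-1 * x)%g; last by rewrite mulVKg.
    split; last exact: subgroupM (subgroupV s1 h1) x1.
    by apply/(Kact h); [exact: s12|rewrite mulVKg].
  by split; [apply/Kact => //; exact: s12|exact: subgroupM].
apply: ae_imp (ae_and u2 io_ae) => w [[_ u] iw]; split.
  have [x0 [ix0 x01] _] := infinite_pick iw (finite_set0 _).
  exists x0; apply: contra_not iw; apply: sub_finite_set => x [ix x1].
  by split=> //; exact: u.
have up x : inf_cluster H1 w x -> inf_cluster H2 w x by exact: inf_cluster_mono.
by move=> x y /up ix /up iy; exact: u.
Qed.

Section Upward.
Hypotheses (p0 : 0 < p) (p1 : p < 1).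
Variables (H1 H2 : set G) (s2 : subgroup H2) (wq : wq_normal H1 H2).
Hypothesis u1 : {ae P, forall w, unique_cluster H1 w}.

Let s1 : subgroup H1. Proof. by case: wq. Qed.
Let s12 : H1 `<=` H2. Proof. by case: wq. Qed.
Let i1 : infinite_set H1. Proof. by case: wq. Qed.

(** The stabilizer in [H2] of the [H1]-infinite cluster, up to null sets. *)
Let I : set G := [set g | H2 g /\
  {ae P, forall w x, inf_cluster H1 w x <-> inf_cluster (lcoset_set g H1) w x}].

Let sI : subgroup I.
Proof.
apply: subgroupP => [|g h [Hg ag] [Hh ah]].
  split; first exact: subgroup1.
  by apply: aeW => w x; rewrite lcoset_set1.
split; first exact: subgroup_div.
set k := (g * h^-1)%g.
apply: ae_imp (ae_and ag (ae_act hP k^-1%g ah)) => w [eg eh] x.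
have kh : lcoset_set g H1 = lcoset_set k (lcoset_set h H1) by rewrite -lcoset_setM /k mulgVK.
rewrite eg kh -[w](actKV k) -[x](mulVKg k) !inf_cluster_act.
by rewrite eh.
Qed.

Let H1I : H1 `<=` I.
Proof.
move=> h h1; split; first exact: s12.
by apply: aeW => w x; rewrite lcoset_set_id.
Qed.

(** Almost surely this is the [H1]-infinite cluster; the quantifier makes it
    [I]-equivariant in every configuration. *)
Let Kin w x := forall g, I g -> inf_cluster (lcoset_set g H1) w x.

Let mKin x : measurable [set w | Kin w x].
Proof.
apply: event_all => // g; apply: event_imp; first exact: event_prop.
exact: measurable_inf_cluster.
Qed.

Let Kact g w x : I g -> Kin (act g w) (g * x)%g <-> Kin w x.
Proof.
move=> Ig; split=> K h Ih.
  by apply/(inf_cluster_act g); rewrite -lcoset_setM; apply: K; exact: subgroupM.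
rewrite -[h](mulVKg g) lcoset_setM; apply/inf_cluster_act/K.
exact: subgroupM (subgroupV sI Ig) Ih.
Qed.

Let Kconn w x y : conn w x y -> Kin w x -> Kin w y.
Proof. by move=> c K g Ig; apply: inf_cluster_conn c _; exact: K. Qed.

Let Kmono w w' x : sub_config w w' -> Kin w x -> Kin w' x.
Proof. by move=> s K g Ig; apply: inf_cluster_mono (K g Ig). Qed.

Let KinE : {ae P, forall w x, Kin w x <-> inf_cluster H1 w x}.
Proof.
have : {ae P, forall w g, I g -> forall x,
    inf_cluster H1 w x <-> inf_cluster (lcoset_set g H1) w x}.
  apply: ae_all => // g; have [Ig|nI] := pselect (I g); last exact: aeW.
  by apply: ae_imp Ig.2.
apply: ae_imp => w h x; split=> [K|i g Ig]; last exact/h.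
by have := K 1%g (subgroup1 sI); rewrite lcoset_set1.
Qed.

Let Kone : {ae P, forall w, one_cluster Kin w}.
Proof.
apply: ae_imp (ae_and KinE u1) => w [K [[x ix] u]].
by split; [exists x; exact/K|move=> y z /K iy /K iz; exact: u].
Qed.

Let I_dominated : {ae P, forall w x, inf_cluster I w x -> Kin w x}.
Proof.
apply: (distinguished_dominates cG genS p0 p1 hP sI) => //.
by apply: contra_not i1; exact: sub_finite_set.
Qed.

(** The translate of the distinguished cluster by [g] is equivariant under the
    intersection of [I] and its conjugate, hence contains infinitely many points
    of [I]. *)
Let I_closed g : H2 g -> infinite_set (conj_set g I `&` I) -> I g.
Proof.
move=> Hg iJ; split=> //; set J := conj_set g I `&` I in iJ.
pose K' w x := Kin (act g^-1%g w) (g^-1 * x)%g.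
have mK' x : measurable [set w | K' w x] by exact: event_act (mKin _).
have K'act j w x : J j -> K' (act j w) (j * x)%g <-> K' w x.
  move=> [[i Ii <-] _]; rewrite /K' -actM !mulgA mulVg mul1g -!mulgA actM.
  exact: Kact.
have nK' : ~ P.-negligible [set w | K' w 1%g].
  have := @everywhere_nonnull Kin g^-1%g p0 Kconn Kmono.
  move=> /(_ (ae_imp (fun w => @proj1 _ _) Kone)); apply: contra_not => n.
  have := null_relabel hP (f := eact g^-1%g) (g := eact g) _ n.
  move=> /(_ (eactKV g)); apply: negligibleS => w /= K.
  by rewrite /K' -/(act g w) actK mulg1.
have K'c j : J j -> P [set w | K' w j] = P [set w | K' w 1%g].
  move=> Jj; rewrite -(act_invariant hP j (mK' j)); congr (P _).
  by apply/seteqP; split=> w /=; rewrite -{2}[j]mulg1 K'act.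
have io := infinitely_often cG iJ mK' K'c (nonnull_gt0 (mK' _) nK').
have K'one : {ae P, forall w, one_cluster Kin (act g^-1%g w)}
  := ae_act hP g^-1%g Kone.
have meet : {ae P, forall w, exists x, K' w x /\ Kin w x}.
  apply: (ergodic p01 hP iJ).
  - by apply: event_ex => // x; apply: event_and.
  - move=> j w Jj; have Ij := Jj.2; split=> -[x [K'x Kx]].
      exists (j^-1 * x)%g; split; [apply/(K'act j)|apply/(Kact _ _ Ij)];
      by rewrite ?mulVKg.
    by exists (j * x)%g; split; [exact/K'act|exact/Kact].
  - apply: nonnullS (nonnull_ae io (ae_and K'one I_dominated)).
    move=> w [iw [[_ u'] dom]].
    have [x0 [K'x0 J0] _] := infinite_pick iw (finite_set0 _).
    exists x0; split=> //; apply: dom.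
    apply: contra_not iw; apply: sub_finite_set => x [K'x [_ Ix]].
    by split=> //=; apply/(conn_act g^-1%g); exact: u'.
have := ae_and (ae_and meet Kone)
  (ae_and K'one (ae_and KinE (ae_act hP g^-1%g KinE))).
apply: ae_imp => w [[[z [K'z Kz]] [_ u]] [[_ u'] [KE KE']]] x.
have gi : inf_cluster (lcoset_set g H1) w x <-> K' w x.
  by rewrite /K' KE' -{1}[w](actKV g) -{1}[x](mulVKg g) inf_cluster_act.
rewrite gi -KE; split=> [Kx|K'x].
  apply: (Kconn (x := g^-1 * z)%g) K'z; apply/conn_act; exact: u.
by apply: Kconn Kz; apply/(conn_act g^-1%g); exact: u'.
Qed.

Lemma unique_wq_normal : {ae P, forall w, unique_cluster H2 w}.
Proof.
have IE : I = H2.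
  apply: contrapT => nE; have [_ _ _] := wq.
  have IH : I `<` H2.
    by split=> [g []//|H21]; apply: nE; apply/seteqP; split=> // g [].
  move=> /(_ I sI H1I IH)[g [Hg nI] inf]; exact: nI (I_closed Hg inf).
have a := ae_and (ae_and u1 Kone) I_dominated; rewrite IE in a.
apply: ae_imp a => w [[[[x ix] _] [_ u]] dom]; split.
  by exists x; exact: inf_cluster_mono ix.
by move=> y z /dom Ky /dom Kz; exact: u.
Qed.

End Upward.

Lemma wq_normal_unique (H1 H2 : set G) : subgroup H2 -> wq_normal H1 H2 ->
  {ae P, forall w, unique_cluster H1 w} <-> {ae P, forall w, unique_cluster H2 w}.
Proof.
move=> s2 wq; have [s1 s12 i1 _] := wq.
have [p0|np0] := eqVneq p 0.
  by split=> /(no_cluster_at_0 p0).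
have pp : 0 < p by rewrite lt_neqAle eq_sym np0; case/andP: p01.
split; last exact: unique_sub.
have [p1|np1] := eqVneq p 1.
  move=> _; apply: unique_cluster_at_1 => //.
  by apply: contra_not i1; exact: sub_finite_set.
apply: unique_wq_normal => //.
by rewrite lt_neqAle np1; case/andP: p01.
Qed.

End Uniqueness.

Theorem proposition1p10 (R : realType) (Gamma : groupType) (S : set Gamma)
    (finS : finite_set S) (genS : generates S) :
  (forall H1 H2 : set Gamma,
      subgroup H1 -> subgroup H2 -> H1 `<=` H2 -> wq_normal H1 H2 ->
      (forall p : R, 0 <= p <= 1 ->
         (as_unique_infinite_cluster S p H1 <->
          as_unique_infinite_cluster S p H2)) /\
      p_u_rel R S H1 = p_u_rel R S H2) /\
  (forall H : set Gamma, subgroup H -> wq_normal H [set: Gamma] ->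
      p_u_rel R S H = p_u R S).
Proof.
have cG := group_countable finS genS.
have uniqE (p : R) A : as_unique_infinite_cluster S p A <->
    {ae bernoulli (edge S) p, forall w, unique_cluster A w}.
  by split; apply: ae_imp => w /unique_infinite_clusterP.
have equiv (H1 H2 : set Gamma) (p : R) : subgroup H2 -> wq_normal H1 H2 ->
    0 <= p <= 1 ->
    as_unique_infinite_cluster S p H1 <-> as_unique_infinite_cluster S p H2.
  move=> s2 wq p01; rewrite !uniqE.
  exact (wq_normal_unique cG genS p01 (percolationP finS genS p01) s2 wq).
have p_u_eq (H1 H2 : set Gamma) : subgroup H2 -> wq_normal H1 H2 ->
    p_u_rel R S H1 = p_u_rel R S H2.
  move=> s2 wq; congr inf; apply/seteqP.
  by split=> p [p01 h]; split=> //; apply/(equiv H1 H2).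
split=> [H1 H2 _ s2 _ wq|H sH wq]; first by split; [move=> p; exact: equiv|exact: p_u_eq].
have sT : subgroup [set: Gamma] by exact: subgroupP.
rewrite (p_u_eq H _ sT wq); congr inf.
have E w : unique_infinite_cluster [set: Gamma] w =
    exists! K : set Gamma, clusters (S := S) w K /\ infinite_set K.
  by congr (ex (unique _)); apply/funext => K; rewrite setIT.
by apply/seteqP; split=> p [p01 h]; split=> //; apply: ae_imp h => w; rewrite E.
Qed.
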